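(* Let $M$ be any $n\times n$ real matrix that is orthogonally diagonalizable (i.e. $M=ODO^T$ with $O$ a real orthogonal matrix and $D$ a real diagonal matrix), and suppose that all of the eigenvalues of $M$ are nonzero and have the same sign. Let $A$ be any anti-symmetric $n\times n$ real matrix. Then the group $G_{M+A}=\{e^{t(M+A)}:t\in\mathbb{R}\}$ is admissible.
   Context: Let $G$ be a closed subgroup of $GL_n(\mathbb{R})$ with a left Haar measure $\mu$. Let $G_\#$ be the group of pairs $(a,b)\in G\times\mathbb{R}^n$ with multiplication $(\alpha,\beta)\cdot(a,b)=(\alpha a,\,b+a^{-1}\beta)$, with left Haar measure $d\lambda(a,b)=d\mu(a)\,db$. For $\psi\in L^2(\mathbb{R}^n)$ set $\psi_{(a,b)}(x)=|\det(a)|^{-1/2}\psi(a^{-1}x-b)$. A function $\psi\in L^2(\mathbb{R}^n)$ is called a continuous wavelet for $G$ if $f=\int_{G_\#}\langle f,\psi_{(a,b)}\rangle\psi_{(a,b)}\,d\lambda(a,b)$ for all $f\in L^2(\mathbb{R}^n)$. By a known result, this is equivalent to the condition $$\Delta_\psi(\xi):=\int_G|\hat\psi(a^T\xi)|^2\,d\mu(a)=1\quad\text{for almost every }\xi\in\mathbb{R}^n\setminus\{0\},$$ where $a^T$ is the transpose of $a$ and $\hat\psi$ is the Fourier transform of $\psi$ (normalized to be unitary on $L^2(\mathbb{R}^n)$). The group $G$ is called admissible if it admits a continuous wavelet, i.e. if there exists $\psi\in L^2(\mathbb{R}^n)$ satisfying $\Delta_\psi(\xi)=1$ for almost every $\xi\in\mathbb{R}^n\setminus\{0\}$.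 *)

(* Defs.v *)
From HB Require Import structures.
From mathcomp Require Import all_boot all_order all_algebra.
From mathcomp Require Import all_classical all_reals all_analysis.
From mathcomp Require Import measurable_realfun complex.

Set Implicit Arguments.
Unset Strict Implicit.
Unset Printing Implicit Defensive.
Import Order.TTheory GRing.Theory Num.Theory.
Import numFieldNormedType.Exports.
Local Open Scope classical_set_scope.
Local Open Scope ring_scope.

Definition matrix_borel_display : measure_display.
Proof. exact. Qed.

Section matrix_borel.
Context {R : realType} {m n : nat}.

Definition matrix_borel : set (set 'M[R]_(m, n)) :=
  <<s [set U : set 'M[R]_(m, n) | open U] >>.

Let matrix_borel0 : matrix_borel set0.
Proof. exact: sigma_algebra0. Qed.

Let matrix_borelC A : matrix_borel A -> matrix_borel (~` A).
Proof. exact: sigma_algebraC. Qed.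

Let matrix_borel_bigcup (F : (set 'M[R]_(m, n))^nat) :
  (forall i, matrix_borel (F i)) -> matrix_borel (\bigcup_i (F i)).
Proof. exact: sigma_algebra_bigcup. Qed.

HB.instance Definition _ := @isMeasurable.Build matrix_borel_display
  'M[R]_(m, n) matrix_borel matrix_borel0 matrix_borelC matrix_borel_bigcup.

(* Sets open for the (norm) topology are countable unions of rational balls;
   hence the Borel sets are also generated by the coordinate functions. *)
Lemma matrix_open_ratball (U : set 'M[R]_(m, n)) : open U ->
  U = \bigcup_(p in [set p : 'M[rat]_(m, n) * rat |
        ball (map_mx ratr p.1 : 'M[R]_(m, n)) (ratr p.2 : R) `<=` U])
      ball (map_mx ratr p.1 : 'M[R]_(m, n)) (ratr p.2 : R).
Proof.
move=> oU; apply/seteqP; split => [M UM|M [p /= pU /pU//]].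
have /nbhs_ballP[e /= e0 eU] : nbhs M U by apply: open_nbhs_nbhs.
have /rat_in_itvoo[q] : 0 < e / 2 by rewrite divr_gt0.
rewrite in_itv/= => /andP[q0 qe].
have ratM i j : exists r : rat, ball (M i j) (ratr q) (ratr r : R).
  have [x [] /=] := @dense_rat R (ball (M i j) (ratr q))
    (ex_intro _ _ (ballxx _ q0)) (ball_open _ _).
  by move=> + [r _ rx]; rewrite -rx; exists r.
pose N : 'M[rat]_(m, n) := \matrix_(i, j) sval (cid (ratM i j)).
have MN : ball M (ratr q) (map_mx ratr N : 'M[R]_(m, n)).
  by split=> // i j; rewrite !mxE; case: cid.
exists (N, q) => /=; last exact: ball_sym.
move=> K NK; apply: eU; apply: (@le_ball _ _ _ (ratr q + ratr q)).
  by rewrite [leRHS]splitr lerD// ltW.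
exact: (ball_triangle MN NK).
Qed.

Lemma measurable_fun_mxP d (T : measurableType d) (f : T -> 'M[R]_(m, n)) :
  measurable_fun [set: T] f <->
  forall i j, measurable_fun [set: T] (fun t => f t i j).
Proof.
split=> [mf i j|mf].
- apply: (@measurableT_comp _ _ _ _ _ _ (fun M : 'M[R]_(m, n) => M i j)) => //.
  apply: (measurability _ (RGenOpens.measurableE R)).
  move=> _ [V [a [b ->]] <-]; rewrite setTI; apply: sub_sigma_algebra => /=.
  by apply: open_comp => [M _|]; [exact: coord_continuous|exact: itv_open].
- apply: (@measurability _ _ _ _ _ _ [set U : set 'M[R]_(m, n) | open U]) => //.
  move=> _ [V /matrix_open_ratball -> <-]; rewrite setTI preimage_bigcup.
  rewrite bigcup_mkcond; apply: countable_bigcupT_measurable => // -[c q].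
  case: ifPn => // _.
  have [q0|q0] := ltP 0 (ratr q : R); last first.
    rewrite (_ : _ @^-1` _ = set0)// -subset0 => t /=.
    by case => /lt_le_trans/(_ q0); rewrite ltxx.
  rewrite (_ : _ @^-1` _ = \bigcap_(ij in [set: 'I_m * 'I_n])
      (fun t => f t ij.1 ij.2) @^-1` ball (ratr (c ij.1 ij.2) : R) (ratr q)).
    apply: fin_bigcap_measurable => // -[i j] _.
    by rewrite -[X in measurable X]setTI; apply: mf => //; exact: measurable_ball.
  apply/seteqP; split => t /=.
    by move=> [_ h] [i j] _ /=; have := h i j; rewrite mxE.
  by move=> h; split => // i j; have := h (i, j) Logic.I; rewrite mxE.
Qed.

End matrix_borel.

Section lebesgue_step.
Context {R : realType} {n : nat}.

Definition cons_cV (p : R * 'cV[R]_n) : 'cV[R]_n.+1 :=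
  (col_mx p.1%:M p.2 : 'cV[R]_(1 + n)).

Lemma cons_cV0 (p : R * 'cV[R]_n) j : cons_cV p ord0 j = p.1.
Proof.
rewrite /cons_cV (_ : ord0 = lshift n (ord0 : 'I_1)); last exact/val_inj.
by rewrite (@col_mxEu R 1 n) !ord1 mxE.
Qed.

Lemma cons_cVS (p : R * 'cV[R]_n) i j : cons_cV p (lift ord0 i) j = p.2 i j.
Proof.
rewrite /cons_cV (_ : lift ord0 i = rshift 1 i); last exact/val_inj.
by rewrite (@col_mxEd R 1 n).
Qed.

Definition uncons_cV (v : 'cV[R]_n.+1) : R * 'cV[R]_n :=
  (v ord0 ord0, \col_i v (lift ord0 i) ord0).

Lemma cons_cVK : cancel cons_cV uncons_cV.
Proof.
case=> x v; rewrite /uncons_cV cons_cV0; congr pair.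
by apply/matrixP => i j; rewrite mxE cons_cVS !ord1.
Qed.

Lemma measurable_cons_cV : measurable_fun [set: R * 'cV[R]_n] cons_cV.
Proof.
apply/measurable_fun_mxP => i j; case: (unliftP ord0 i) => [k|] ->.
  under eq_fun do rewrite cons_cVS.
  have h := @measurable_snd _ _ R 'cV[R]_n.
  exact: (proj1 (measurable_fun_mxP _) h).
by under eq_fun do rewrite cons_cV0; exact: measurable_fst.
Qed.

Variable mu : {sigma_finite_measure set 'cV[R]_n -> \bar R}.

Definition lebesgue_step (A : set 'cV[R]_n.+1) : \bar R :=
  pushforward (lebesgue_measure \x mu)%E cons_cV A.

Let pf : {measure set 'cV[R]_n.+1 -> \bar R} :=
  measure_function_pushforward__canonical__measure_function_Measure
    (lebesgue_measure \x mu)%E measurable_cons_cV.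

Let lebesgue_step0 : lebesgue_step set0 = 0%E.
Proof. exact: (measure0 pf). Qed.

Let lebesgue_step_ge0 A : (0 <= lebesgue_step A)%E.
Proof. exact: (measure_ge0 pf). Qed.

Let lebesgue_step_sigma_additive : semi_sigma_additive lebesgue_step.
Proof. exact: (@measure_semi_sigma_additive _ _ _ pf). Qed.

HB.instance Definition _ := isMeasure.Build _ _ _ lebesgue_step
  lebesgue_step0 lebesgue_step_ge0 lebesgue_step_sigma_additive.

Let lebesgue_step_sigma_finite : sigma_finite setT lebesgue_step.
Proof.
have /sigma_finiteP[F [TF ndF Foo]] := sigma_finiteT (@lebesgue_measure R).
have /sigma_finiteP[G [TG ndG Goo]] := sigma_finiteT mu.
have mcoord i j : measurable_fun [set: 'cV[R]_n.+1] (fun v => v i j).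
  have h := @measurable_id _ 'cV[R]_n.+1 setT.
  exact: (proj1 (measurable_fun_mxP _) h).
have mg : measurable_fun setT uncons_cV.
  apply: measurable_fun_pair; first exact: mcoord.
  apply/measurable_fun_mxP => i j.
  by under eq_fun do rewrite mxE; exact: mcoord.
exists (fun k => uncons_cV @^-1` (F k `*` G k)).
  apply/seteqP; split => // v _.
  have [k _ Fk] : (\bigcup_i F i) (uncons_cV v).1 by rewrite -TF.
  have [l _ Gl] : (\bigcup_i G i) (uncons_cV v).2 by rewrite -TG.
  exists (maxn k l) => //; split.
    by move: Fk; exact/subsetPset/ndF/leq_maxl.
  by move: Gl; exact/subsetPset/ndG/leq_maxr.
move=> k; have [mF Fk] := Foo k; have [mG Gk] := Goo k.
have mFG : measurable (F k `*` G k) by exact: measurableX.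
split; first by rewrite -[X in measurable X]setTI; exact: mg.
rewrite /lebesgue_step /pushforward -comp_preimage.
rewrite (_ : uncons_cV \o cons_cV = id) ?preimage_id; last first.
  exact/funext/cons_cVK.
by rewrite product_measure1E// lte_mul_pinfty// ge0_fin_numE.
Qed.

HB.instance Definition _ := Measure_isSigmaFinite.Build _ _ _ lebesgue_step
  lebesgue_step_sigma_finite.

End lebesgue_step.

(* Lebesgue measure on R^n, as the n-fold product of lebesgue_measure: the head
   coordinate is split off, R^(n+1) being identified with R * R^n. *)
Fixpoint lebesgue_cV {R : realType} (n : nat) :
    {sigma_finite_measure set 'cV[R]_n -> \bar R} :=
  match n with
  | 0 => \d_(0 : 'cV[R]_0)
  | n'.+1 => lebesgue_step (lebesgue_cV n')
  end.

Section complex_L2.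
Context {R : realType} {n : nat}.
Implicit Types (f g : 'cV[R]_n -> R[i]).

Definition LnormC (p : \bar R) f : \bar R :=
  ('N[lebesgue_cV n]_p[(fun x => (Normc.normc (f x))%:E)])%E.

Definition LpC (p : \bar R) f : Prop :=
  [/\ measurable_fun setT (fun x => complex.Re (f x)),
      measurable_fun setT (fun x => complex.Im (f x)) &
      (LnormC p f < +oo)%E].

Definition integralC f : R[i] :=
  Complex (\int[lebesgue_cV n]_x complex.Re (f x))
          (\int[lebesgue_cV n]_x complex.Im (f x)).

Definition dotv (x y : 'cV[R]_n) : R := \sum_(i < n) x i 0 * y i 0.

Definition expi (t : R) : R[i] := Complex (cos t) (sin t).

Definition fourier f (xi : 'cV[R]_n) : R[i] :=
  integralC (fun x => f x * expi (- (2 * pi * dotv x xi))).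

(* The integral defining [fourier f] makes sense for f in L^1 only. On L^2 the
   Fourier transform is the continuous extension of its restriction to the dense
   subspace L^1 /\ L^2, on which it is an L^2-isometry for the normalisation
   chosen above. [is_fourier_L2 f g] says that g represents the Fourier
   transform of f; g is determined up to equality almost everywhere. *)
Definition is_fourier_L2 f g : Prop :=
  [/\ LpC 2%:E f, LpC 2%:E g &
    exists f_ : nat -> 'cV[R]_n -> R[i],
      [/\ forall k, LpC 1%:E (f_ k) /\ LpC 2%:E (f_ k),
          LnormC 2%:E (fun x => f_ k x - f x) @[k --> \oo] --> 0%E &
          LnormC 2%:E (fun xi => fourier (f_ k) xi - g xi) @[k --> \oo]
            --> 0%E]].

End complex_L2.

Section admissible.
Context {R : realType} {n : nat}.
Implicit Types (G : set 'M[R]_n) (mu : {measure set 'M[R]_n -> \bar R}).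

Record closed_subgroup_GL G : Prop := ClosedSubgroupGL {
  csg_unit : forall a, G a -> a \in unitmx;
  csg_one : G 1%:M;
  csg_mul : forall a b, G a -> G b -> G (a *m b);
  csg_inv : forall a, G a -> G (invmx a);
  (* closed in GL_n(R), not necessarily in the space of all matrices *)
  csg_closed : forall a, a \in unitmx -> closure G a -> G a }.

(* A measure on G is encoded as a Borel measure on the space of all matrices
   carried by G. As G is second countable and locally compact, a Borel measure
   that is finite on compact sets is automatically regular. *)
Record left_haar_measure G mu : Prop := LeftHaarMeasure {
  haar_carried : mu (~` G) = 0%E;
  haar_neq0 : mu G != 0%E;
  haar_compact : forall K, compact K -> K `<=` G -> (mu K < +oo)%E;
  haar_invariant : forall a B, G a -> measurable B ->
    mu [set a *m b | b in B] = mu B }.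

(* Delta_psi, as a function of g, the Fourier transform of psi *)
Definition Delta G mu (g : 'cV[R]_n -> R[i]) (xi : 'cV[R]_n) : \bar R :=
  (\int[mu]_(a in G) (Normc.normc (g (a^T *m xi)) ^+ 2)%:E)%E.

(* Haar measures on G exist and are unique up to a positive factor, so that the
   condition does not depend on the choice of mu. *)
Definition admissible G : Prop :=
  closed_subgroup_GL G /\
  forall mu, left_haar_measure G mu ->
    exists psi psihat : 'cV[R]_n -> R[i],
      [/\ LpC 2%:E psi, is_fourier_L2 psi psihat &
          {ae lebesgue_cV n, forall xi, xi != 0 -> Delta G mu psihat xi = 1%E}].

Definition orthogonally_diagonalizable (M : 'M[R]_n) : Prop :=
  exists O D : 'M[R]_n,
    [/\ O *m O^T = 1%:M, is_diag_mx D & M = O *m D *m O^T].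

Definition expmx (B : 'M[R]_n) : 'M[R]_n :=
  limn (series (fun k => k`!%:R^-1 *: B ^+ k)).

Definition one_param_group (B : 'M[R]_n) : set 'M[R]_n :=
  range (fun t : R => expmx (t *: B)).

End admissible.

(* Main.v *)
Require Import Defs.
From HB Require Import structures.
From mathcomp Require Import all_boot all_order all_algebra.
From mathcomp Require Import all_classical all_reals all_analysis.
From mathcomp Require Import measurable_realfun complex.
From mathcomp Require Import ring lra.
Import Order.TTheory GRing.Theory Num.Theory.
Import numFieldNormedType.Exports.
Set Implicit Arguments.
Unset Strict Implicit.
Unset Printing Implicit Defensive.
Local Open Scope classical_set_scope.
Local Open Scope ring_scope.

(** The proof produces a wavelet whose Fourier transform is a multiple of the
    indicator function of an open shell.

    Let [B = M + A] and [E t = exp (t B)]. If [M] is positive definite (otherwise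
    replace [B] by [- B], which generates the same group), then along an orbit
    [t |-> (E t)^T xi] the squared norm [N] has derivative
    [2 <v, B^T v> = 2 <v, M v> >= 2 c N], since the antisymmetric part does not
    contribute. So [N] increases from [0] to [+oo] when [xi != 0]
    ([flow_sqnorm_growth]), it takes the value [1] at exactly one time [s], and
    the orbit lies in the open bounded set
    [shell B = {v : 1 < |v|^2, |(E (- 1))^T v|^2 < 1}] exactly for [s < t < s + 1]
    ([shell_orbit]). The properness of the orbits also shows that the group is
    closed. If [mu] is a left Haar measure, the arc of the [E t] with
    [s < t < s + 1] is the translate by [E s] of the arc of the [E t] with
    [0 < t < 1], so its measure is a constant [c]
    independent of [xi]; [c] is finite because the arc is relatively compact, and
    positive because countably many of its translates cover the group. Hence
    [c^(-1/2)] times the indicator function of the shell satisfies the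
    admissibility condition at every nonzero [xi] ([Delta_shell]); the
    uniqueness of Haar measures plays no role.

    It remains to see that [g = kap 1_U], for [U] open of finite measure, is the
    Fourier transform of a square-integrable function ([is_fourier_L2_step]).
    Put [psi x = \int g(xi) exp (2 i pi x.xi) dxi] and
    [psi_k x = exp (- eps_k \sum_i |x_i|) psi x] with [eps_k -> 0]. By Fubini the
    Fourier transform of [psi_k] is the convolution [g * P_k] of [g] with the
    product [P_k] of one-dimensional Poisson kernels
    ([integral_damp_cos], [fourier_psi_]), and
    [\int exp (- eps_k \sum_i |x_i|) |psi|^2 = \int g (g * P_k) <= \int g^2];
    Fatou's lemma then gives [psi] in L^2 ([integral_power_le]) and dominated
    convergence gives [psi_k -> psi] in L^2. Finally
    [(g * P_k - g)^2 <= kap (g * P_k) + kap g - 2 g (g * P_k)] pointwise, the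
    first two terms on the right have the integral [kap \int g] each, and
    [\int g (g * P_k) -> kap \int g] because [P_k] concentrates at the origin and
    [U] is open; so [g * P_k -> g] in L^2 ([cvg_smear_L2]). *)

(** * The matrix exponential *)

Section matrix_exponential.
Context {R : realType} {n : nat}.
Implicit Types (B X : 'M[R]_n) (t : R).

Lemma cvg_mx_entries {T : Type} (F : set_system T) {FF : Filter F} m p
  (f : T -> 'M[R]_(m, p)) (M : 'M[R]_(m, p)) :
  (forall i j, f x i j @[x --> F] --> M i j) -> f x @[x --> F] --> M.
Proof.
move=> h; apply/cvg_ballP => e e0.
have : \forall x \near F, forall i, forall j, ball (M i j) e (f x i j).
  apply: filter_forall => i; apply: filter_forall => j.
  by have /cvg_ballP/(_ e e0) := h i j.
by apply: filterS => x hx; split.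
Qed.

Lemma cvg_sumr {T : Type} (F : set_system T) {FF : Filter F} m
  (f : 'I_m -> T -> R) (a : 'I_m -> R) :
  (forall i, f i x @[x --> F] --> a i) ->
  \sum_i f i x @[x --> F] --> \sum_i a i.
Proof.
by move=> h; apply: (@cvg_big R 'I_m +%R 0 xpredT (@add_continuous R)).
Qed.

(** The sum of the absolute values of the entries is submultiplicative. *)
Lemma expr_mx_entry_le B k i j :
  `|(B ^+ k) i j| <= (\sum_p \sum_q `|B p q|) ^+ k.
Proof.
elim: k i j => [|k IH] i j.
  by rewrite !expr0 mxE; case: eqP => _; rewrite ?normr1 ?normr0 ?ler01.
rewrite exprS mxE (le_trans (ler_norm_sum _ _ _))// exprS.
apply: (@le_trans _ _ (\sum_q `|B i q| * (\sum_p \sum_q `|B p q|) ^+ k)).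
  by apply: ler_sum => q _; rewrite normrM ler_wpM2l.
rewrite -mulr_suml ler_wpM2r//.
  by rewrite exprn_ge0// sumr_ge0// => p _; rewrite sumr_ge0.
by rewrite [leRHS](bigD1 i)//= lerDl sumr_ge0// => p _; rewrite sumr_ge0.
Qed.

Lemma expr_scalemx t B k : (t *: B) ^+ k = t ^+ k *: B ^+ k.
Proof.
elim: k => [|k IH]; first by rewrite !expr0 scale1r.
rewrite !exprS IH; change (t *: B *m (t ^+ k *: B ^+ k) = (t * t ^+ k) *: (B *m B ^+ k)).
by rewrite -scalemxAl -scalemxAr scalerA.
Qed.

(** Coefficients of the power series in [t] of the entry [(i, j)] of
    [B ^+ m *m expmx (t *: B)]; the shift [m] makes the family stable under
    termwise differentiation. *)
Definition expmx_coeff B (m : nat) i j (k : nat) : R :=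
  k`!%:R^-1 * (B ^+ (k + m)) i j.

Lemma is_cvg_expmx_coeff B m i j t : cvgn (pseries (expmx_coeff B m i j) t).
Proof.
apply: normed_cvg; set b := \sum_p \sum_q `|B p q|.
have b0 : 0 <= b by apply: sumr_ge0 => p _; apply: sumr_ge0.
apply: (@series_le_cvg _ _ (b ^+ m *: exp_coeff (b * `|t|))).
- by move=> k /=; exact: normr_ge0.
- move=> k; rewrite /= /exp_coeff !fctE /= mulr_ge0 ?exprn_ge0//.
  by rewrite divr_ge0 ?exprn_ge0 ?mulr_ge0.
- move=> k /=; rewrite /expmx_coeff /exp_coeff !normrM normfV normr_nat normrX.
  have -> : (b ^+ m *: (fun n0 => (b * `|t|) ^+ n0 / n0`!%:R)) k =
    (k`!%:R)^-1 * b ^+ (k + m) * `|t| ^+ k.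
    by rewrite /= !fctE /GRing.scale /= exprMn exprD; ring.
  rewrite ler_wpM2r ?exprn_ge0// ler_wpM2l ?invr_ge0//.
  exact: expr_mx_entry_le.
- by apply: is_cvg_seriesZ; exact: is_cvg_series_exp_coeff.
Qed.

Lemma pseries_diffs_expmx_coeff B m i j :
  pseries_diffs (expmx_coeff B m i j) = expmx_coeff B m.+1 i j.
Proof.
apply/funext => k; rewrite /pseries_diffs /expmx_coeff factS natrM invfM.
by rewrite !mulrA divff ?pnatr_eq0// mul1r addSnnS.
Qed.

Lemma expmx_entry B t i j :
  expmx (t *: B) i j = limn (pseries (expmx_coeff B 0 i j) t).
Proof.
rewrite /expmx.
suff -> : limn (series (fun k => k`!%:R^-1 *: (t *: B) ^+ k)) =
  \matrix_(i, j) limn (pseries (expmx_coeff B 0 i j) t) by rewrite mxE.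
apply: cvg_lim; first exact: norm_hausdorff.
apply: cvg_mx_entries => {}i {}j; rewrite mxE.
rewrite (_ : (fun x => _) = pseries (expmx_coeff B 0 i j) t).
  exact: is_cvg_expmx_coeff.
apply/funext => N; rewrite /series /= summxE; apply: eq_bigr => k _.
rewrite expr_scalemx !mxE /=. by rewrite /expmx_coeff addn0; ring.
Qed.

Lemma is_derive_expmx_coeff B t i j : is_derive t (1 : R)
  (fun t => expmx (t *: B) i j) (limn (pseries (expmx_coeff B 1 i j) t)).
Proof.
rewrite -(pseries_diffs_expmx_coeff B 0).
have -> : (fun t => expmx (t *: B) i j) =
    (fun t => limn (pseries (expmx_coeff B 0 i j) t)).
  by apply/funext => s; exact: expmx_entry.
apply: (@pseries_snd_diffs _ _ (`|t| + 1)).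
- exact: is_cvg_expmx_coeff.
- by rewrite pseries_diffs_expmx_coeff; exact: is_cvg_expmx_coeff.
- by rewrite !pseries_diffs_expmx_coeff; exact: is_cvg_expmx_coeff.
- by rewrite [ltRHS]ger0_norm ?ltrDl// addr_ge0.
Qed.

Lemma is_derive_expmxl B t i j : is_derive t (1 : R)
  (fun t => expmx (t *: B) i j) ((B *m expmx (t *: B)) i j).
Proof.
suff <- : limn (pseries (expmx_coeff B 1 i j) t) = (B *m expmx (t *: B)) i j.
  exact: is_derive_expmx_coeff.
rewrite mxE.
apply: cvg_lim => //.
rewrite (_ : pseries _ _ =
  (fun N => \sum_l B i l * pseries (expmx_coeff B 0 l j) t N)).
  apply: cvg_sumr => l; apply: cvgMl_tmp; rewrite expmx_entry.
  exact: is_cvg_expmx_coeff.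
apply/funext => N; rewrite /pseries /series /=.
under [RHS]eq_bigr do rewrite mulr_sumr.
rewrite exchange_big /=; apply: eq_bigr => k _.
rewrite /expmx_coeff addn1 exprS mxE mulr_sumr mulr_suml.
by apply: eq_bigr => l _; rewrite addn0; ring.
Qed.

Lemma is_derive_expmxr B t i j : is_derive t (1 : R)
  (fun t => expmx (t *: B) i j) ((expmx (t *: B) *m B) i j).
Proof.
suff <- : limn (pseries (expmx_coeff B 1 i j) t) = (expmx (t *: B) *m B) i j.
  exact: is_derive_expmx_coeff.
rewrite mxE.
apply: cvg_lim => //.
rewrite (_ : pseries _ _ =
  (fun N => \sum_l pseries (expmx_coeff B 0 i l) t N * B l j)).
  apply: cvg_sumr => l; apply: cvgMr_tmp; rewrite expmx_entry.
  exact: is_cvg_expmx_coeff.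
apply/funext => N; rewrite /pseries /series /=.
under [RHS]eq_bigr do rewrite mulr_suml.
rewrite exchange_big /=; apply: eq_bigr => k _.
rewrite /expmx_coeff addn1 exprSr mxE mulr_sumr mulr_suml.
by apply: eq_bigr => l _; rewrite addn0; ring.
Qed.

Lemma expmx0 : expmx (0 : 'M[R]_n) = 1%:M.
Proof.
apply/matrixP => i j; rewrite -(scale0r 0) expmx_entry.
apply: cvg_lim => //; apply: cvg_near_cst; exists 1%N => // N /= N0.
rewrite /pseries /series /= big_ltn// big_nat_cond big1 ?addr0.
  by rewrite expr0 mulr1 /expmx_coeff addn0 expr0 fact0 invr1 mul1r.
by move=> k /andP[/andP[k0 _] _]; rewrite expr0n gtn_eqF// mulr0.
Qed.

(** The left-hand side is constant in [t], as [B] commutes with its exponential. *)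
Lemma expmxB B s t : expmx ((s - t) *: B) *m expmx (t *: B) = expmx (s *: B).
Proof.
apply/matrixP => i j; rewrite mxE.
pose H t := \sum_l expmx ((s - t) *: B) i l * expmx (t *: B) l j.
have dH u : is_derive u (1 : R) H 0.
  have dk l : is_derive u (1 : R)
     (fun t => expmx ((s - t) *: B) i l * expmx (t *: B) l j)
     (expmx ((s - u) *: B) i l * (B *m expmx (u *: B)) l j
     - (expmx ((s - u) *: B) *m B) i l * expmx (u *: B) l j).
    have h1 := is_derive_expmxl B u l j.
    have h2 : is_derive u (1 : R) (fun t => expmx ((s - t) *: B) i l)
        (- (expmx ((s - u) *: B) *m B) i l).
      have h3 : is_derive u (1 : R) (fun t => s - t) (- 1).
        by rewrite -[X in is_derive _ _ _ X]sub0r; exact: is_deriveB.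
      have := @is_derive1_comp _ (fun t => expmx (t *: B) i l) (fun t => s - t)
        u _ _ (is_derive_expmxr B (s - u) i l) h3.
      by rewrite mulrN1.
    apply: (is_derive_eq (is_deriveM h2 h1)).
    by rewrite /GRing.scale /=; ring.
  have -> : H = \sum_l (fun t => expmx ((s - t) *: B) i l * expmx (t *: B) l j).
    by apply/funext => v; rewrite fct_sumE.
  apply: (is_derive_eq (is_derive_sum dk)).
  rewrite sumrB; apply/eqP; rewrite subr_eq0; apply/eqP.
  transitivity ((expmx ((s - u) *: B) *m B *m expmx (u *: B)) i j).
    by rewrite -mulmxA [RHS]mxE.
  by rewrite mxE.
have -> : \sum_j0 expmx ((s - t) *: B) i j0 * expmx (t *: B) j0 j = H t by [].
rewrite (is_derive_0_is_cst t 0 dH) /H subr0 scale0r expmx0.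
transitivity ((expmx (s *: B) *m 1%:M) i j); first by rewrite mxE.
by rewrite mulmx1.
Qed.

Lemma expmxD B s t : expmx ((s + t) *: B) = expmx (s *: B) *m expmx (t *: B).
Proof. by rewrite -[in RHS](addrK t s) expmxB. Qed.

Lemma expmxN B t : expmx (t *: B) *m expmx ((- t) *: B) = 1%:M.
Proof. by rewrite -expmxD subrr scale0r expmx0. Qed.

Lemma expmx_unit B t : expmx (t *: B) \in unitmx.
Proof. by have /mulmx1_unit[] := expmxN B t. Qed.

Lemma invmx_expmx B t : invmx (expmx (t *: B)) = expmx ((- t) *: B).
Proof.
by rewrite -[LHS]mulmx1 -(expmxN B t) mulmxA mulVmx ?mul1mx// expmx_unit.
Qed.

Lemma continuous_expmx B : continuous (fun t => expmx (t *: B)).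
Proof.
move=> t; apply: cvg_mx_entries => i j.
have h : derivable (fun t => expmx (t *: B) i j) t 1.
  by case: (is_derive_expmxl B t i j).
by move/derivable1_diffP/differentiable_continuous: h.
Qed.

End matrix_exponential.

(** * Expanding one-parameter flows *)

Section expanding_flow.
Context {R : realType} {n : nat}.
Implicit Types (B X : 'M[R]_n) (t : R) (v w xi : 'cV[R]_n).

Lemma dotvE v w : dotv v w = (v^T *m w) 0 0.
Proof. by rewrite mxE /dotv; apply: eq_bigr => i _; rewrite mxE. Qed.

Lemma dotv_ge0 v : 0 <= dotv v v.
Proof. by apply: sumr_ge0 => i _; rewrite -expr2 sqr_ge0. Qed.

Lemma dotv_eq0 v : (dotv v v == 0) = (v == 0).
Proof.
apply/idP/eqP => [|->]; last by rewrite /dotv big1// => i _; rewrite mxE mul0r.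
rewrite /dotv psumr_eq0; last by move=> i _; rewrite -expr2 sqr_ge0.
move=> /allP h; apply/matrixP => i j; rewrite ord1 mxE.
have := h i; rewrite mem_index_enum => /(_ isT) /=.
by rewrite mulf_eq0 orbb => /eqP.
Qed.

Lemma dotv_gt0 v : v != 0 -> 0 < dotv v v.
Proof. by move=> v0; rewrite lt_neqAle dotv_ge0 andbT eq_sym dotv_eq0. Qed.

Lemma continuous_dotv {T : topologicalType} (f : T -> 'cV[R]_n) x :
  (forall i, {for x, continuous (fun y => f y i 0)}) ->
  {for x, continuous (fun y => dotv (f y) (f y))}.
Proof. by move=> h; apply: cvg_sumr => i; apply: cvgM; exact: h. Qed.

Lemma continuous_dotv_mulmxr X : continuous (fun v => dotv (X *m v) (X *m v)).
Proof.
move=> v; apply: continuous_dotv => i; rewrite /prop_for /continuous_at.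
under eq_fun do rewrite mxE; rewrite mxE.
apply: (@cvg_sumr R _ (nbhs v)) => k; apply: cvgMl_tmp; exact: coord_continuous.
Qed.

Lemma continuous_dotv_trmul xi :
  continuous (fun a : 'M[R]_n => dotv (a^T *m xi) (a^T *m xi)).
Proof.
move=> a; apply: (@continuous_dotv _ (fun a : 'M[R]_n => a^T *m xi)) => i; rewrite /prop_for /continuous_at.
under eq_fun do rewrite mxE; rewrite mxE.
apply: (@cvg_sumr R _ (nbhs a)) => k; apply: cvgMr_tmp; rewrite mxE.
under eq_fun do rewrite mxE; exact: coord_continuous.
Qed.

(** The squared Euclidean norm along the orbit of [xi] under the transposed flow. *)
Definition flow_sqnorm B xi t : R :=
  dotv ((expmx (t *: B))^T *m xi) ((expmx (t *: B))^T *m xi).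

Lemma is_derive_flow_sqnorm B xi t : is_derive t (1 : R) (flow_sqnorm B xi)
  (2 * dotv ((expmx (t *: B))^T *m xi)
            (B^T *m ((expmx (t *: B))^T *m xi))).
Proof.
pose v s i := ((expmx (s *: B))^T *m xi) i 0.
have dv i : is_derive t (1 : R) (v^~ i) ((B^T *m ((expmx (t *: B))^T *m xi)) i 0).
  have -> : v^~ i = \sum_j (fun s => xi j 0 *: expmx (s *: B) j i).
    apply/funext => s; rewrite fct_sumE /v mxE; apply: eq_bigr => j _.
    by rewrite mxE /GRing.scale /= mulrC.
  have dj j : is_derive t (1 : R) (fun s => xi j 0 *: expmx (s *: B) j i)
      (xi j 0 *: (expmx (t *: B) *m B) j i).
    by have h := is_derive_expmxr B t j i; exact: is_deriveZ.
  apply: (is_derive_eq (is_derive_sum dj)).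
  rewrite mulmxA -trmx_mul mxE; apply: eq_bigr => j _.
  by rewrite [in RHS]mxE /GRing.scale /= mulrC.
have -> : flow_sqnorm B xi = \sum_i (fun s => v s i * v s i).
  by apply/funext => s; rewrite fct_sumE.
have dvv i : is_derive t (1 : R) (fun s => v s i * v s i)
   (2 * (v t i * (B^T *m ((expmx (t *: B))^T *m xi)) i 0)).
  apply: (is_derive_eq (is_deriveM (dv i) (dv i))).
  by rewrite /GRing.scale /=; ring.
by apply: (is_derive_eq (is_derive_sum dvv)); rewrite -mulr_sumr.
Qed.

Lemma continuous_flow_sqnorm B xi : continuous (flow_sqnorm B xi).
Proof.
move=> t; have [h _] := is_derive_flow_sqnorm B xi t.
by move/derivable1_diffP/differentiable_continuous: h.
Qed.

Lemma flow_sqnorm_shift B xi s t :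
  flow_sqnorm B ((expmx (s *: B))^T *m xi) t = flow_sqnorm B xi (s + t).
Proof. by rewrite /flow_sqnorm mulmxA -trmx_mul -expmxD. Qed.

Lemma flow_sqnorm0 B xi : flow_sqnorm B xi 0 = dotv xi xi.
Proof. by rewrite /flow_sqnorm scale0r expmx0 trmx1 mul1mx. Qed.

Lemma flow_sqnorm_gt0 B xi t : xi != 0 -> 0 < flow_sqnorm B xi t.
Proof.
move=> xi0; apply: dotv_gt0; apply: contra_neq xi0 => h.
have : (expmx (t *: B))^T \in unitmx by rewrite unitmx_tr expmx_unit.
by move=> u; rewrite -[LHS](mulKmx u) h mulmx0.
Qed.

(** The symmetric part of [B] is positive definite, with a uniform lower bound. *)
Definition expanding B := exists2 c : R, 0 < c &
  forall v, c * dotv v v <= dotv v (B^T *m v).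

(** The growth is in fact exponential, since [flow_sqnorm B xi t * expR (- c * t)]
    is nondecreasing; an affine lower bound is enough for what follows. *)
Lemma flow_sqnorm_growth B : expanding B ->
  exists2 c : R, 0 < c & forall xi s t, s <= t ->
    flow_sqnorm B xi s * (1 + c * (t - s)) <= flow_sqnorm B xi t.
Proof.
move=> [c c0 hc]; exists (2 * c); first by rewrite mulr_gt0.
move=> xi s t; rewrite le_eqVlt => /predU1P[->|st].
  by rewrite subrr mulr0 addr0 mulr1.
apply: (@le_trans _ _ (flow_sqnorm B xi s * expR (2 * c * (t - s)))).
  by rewrite ler_wpM2l ?dotv_ge0// expR_ge1Dx.
pose g u := flow_sqnorm B xi u * expR (- (2 * c) * u).
pose dg u := (2 * dotv ((expmx (u *: B))^T *m xi)
     (B^T *m ((expmx (u *: B))^T *m xi)) - 2 * c * flow_sqnorm B xi u)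
   * expR (- (2 * c) * u).
have dgP u : is_derive u (1 : R) g (dg u).
  have h1 := is_derive_flow_sqnorm B xi u.
  have h2 : is_derive u (1 : R) (fun u => - (2 * c) *: u) (- (2 * c)).
    apply: (is_derive_eq (is_deriveZ (- (2 * c)) (is_derive_id u (1 : R)))).
    by rewrite /GRing.scale /= mulr1.
  have h3 := is_derive1_comp (is_derive_expR _) h2.
  apply: (is_derive_eq (is_deriveM h1 h3)).
  by rewrite /dg /GRing.scale /= /GRing.scale /=; ring.
have gc : continuous g.
  move=> u; have [h _] := dgP u.
  by move/derivable1_diffP/differentiable_continuous: h.
have [u _ gE] := @MVT R g dg s t st (fun x _ => dgP x)
  (continuous_subspaceT gc).
have : 0 <= g t - g s.
  rewrite gE mulr_ge0 ?subr_ge0 ?(ltW st)// /dg mulr_ge0 ?expR_ge0//.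
  by rewrite subr_ge0 -mulrA ler_wpM2l ?hc.
rewrite subr_ge0 /g => h.
have -> : 2 * c * (t - s) = - (2 * c) * s + 2 * c * t by ring.
rewrite expRD mulrA -ler_pdivlMr ?expR_gt0// (le_trans h)//.
by rewrite -expRN mulNr.
Qed.

Lemma flow_sqnorm_lt B xi s t : expanding B -> xi != 0 ->
  (flow_sqnorm B xi s < flow_sqnorm B xi t) = (s < t).
Proof.
move=> hB xi0; have [c c0 hc] := flow_sqnorm_growth hB.
have mono a b : a < b -> flow_sqnorm B xi a < flow_sqnorm B xi b.
  move=> ab; apply: lt_le_trans (hc xi a b (ltW ab)).
  by rewrite ltr_pMr ?flow_sqnorm_gt0// ltrDl mulr_gt0// subr_gt0.
case: (ltgtP s t) => [/mono//|/mono|->]; last by rewrite ltxx.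
by move=> /ltW; rewrite leNgt => /negbTE.
Qed.

Lemma flow_sqnorm_ge B xi K : expanding B -> xi != 0 ->
  exists2 t, 0 <= t & K <= flow_sqnorm B xi t.
Proof.
move=> hB xi0; have [c c0 hc] := flow_sqnorm_growth hB.
have d0 : 0 < dotv xi xi by exact: dotv_gt0.
exists (`|K| / (c * dotv xi xi)); first by rewrite divr_ge0// mulr_ge0// ltW.
apply: le_trans (hc xi 0 _ _); last by rewrite divr_ge0// mulr_ge0// ltW.
rewrite flow_sqnorm0 subr0 mulrDr mulr1.
have -> : dotv xi xi * (c * (`|K| / (c * dotv xi xi))) = `|K|.
  by field; rewrite !gt_eqF.
by rewrite (le_trans (ler_norm _))// lerDr ltW.
Qed.

Lemma flow_sqnorm_le B xi e : expanding B -> 0 < e ->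
  exists2 t, t <= 0 & flow_sqnorm B xi t <= e.
Proof.
move=> hB e0; have [c c0 hc] := flow_sqnorm_growth hB.
have d0 : 0 <= dotv xi xi by exact: dotv_ge0.
have t0 : - (dotv xi xi / (c * e)) <= 0.
  by rewrite oppr_le0 divr_ge0// mulr_ge0// ltW.
exists (- (dotv xi xi / (c * e))) => //.
have := hc xi _ _ t0; rewrite flow_sqnorm0 sub0r opprK.
have -> : c * (dotv xi xi / (c * e)) = dotv xi xi / e.
  by field; rewrite !gt_eqF.
move=> h; have : flow_sqnorm B xi (- (dotv xi xi / (c * e))) * (dotv xi xi / e + 1)
   <= e * (dotv xi xi / e + 1).
  rewrite addrC (le_trans h)// mulrDr mulr1 mulrCA divff ?mulr1 ?gt_eqF//.
  by rewrite lerDr ltW.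
by rewrite ler_pM2r// ltr_wpDl// divr_ge0// ltW.
Qed.

Lemma flow_sqnorm_eq1 B xi : expanding B -> xi != 0 ->
  exists s, flow_sqnorm B xi s = 1.
Proof.
move=> hB xi0.
have [b b0 hb] := flow_sqnorm_ge 1 hB xi0.
have [a a0 ha] := flow_sqnorm_le xi hB (@ltr01 R).
have [//||s _ sE] := @IVT R (flow_sqnorm B xi) a b 1 (le_trans a0 b0).
- by apply: continuous_subspaceT; exact: continuous_flow_sqnorm.
- by apply/andP; split; [rewrite ge_min; apply/orP; left|rewrite le_max; apply/orP; right].
- by exists s.
Qed.

(** For an expanding [B], the set of the points whose orbit crossed the unit
    sphere less than one unit of time ago. *)
Definition shell B : set 'cV[R]_n :=
  [set v | 1 < dotv v v /\ flow_sqnorm B v (- 1) < 1].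

Lemma open_shell B : open (shell B).
Proof.
have -> : shell B =
    (fun v => dotv (1%:M *m v) (1%:M *m v)) @^-1` [set x | 1 < x] `&`
    (fun v => flow_sqnorm B v (- 1)) @^-1` [set x | x < 1].
  by apply/seteqP; split => v; rewrite /shell /= mul1mx.
apply: openI; apply: open_comp.
- by move=> v _; exact: continuous_dotv_mulmxr.
- exact: open_gt.
- by move=> v _; exact: continuous_dotv_mulmxr.
- exact: open_lt.
Qed.

Lemma bounded_shell B : exists r : R, forall v, shell B v -> forall i, `|v i 0| <= r.
Proof.
exists (\sum_i \sum_j `|(expmx (1 *: B))^T i j|) => v [_ hv] i.
pose w := (expmx ((- 1) *: B))^T *m v.
have vE : v = (expmx (1 *: B))^T *m w.
  rewrite /w mulmxA -trmx_mul -[X in _ *m expmx (X *: _)](opprK 1) expmxN.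
  by rewrite trmx1 mul1mx.
have hw j : `|w j 0| <= 1.
  rewrite -(@ler_sqr R _ 1) ?nnegrE// expr1n real_normK ?num_real//.
  apply: (le_trans _ (ltW hv)); rewrite /flow_sqnorm -/w /dotv (bigD1 j)//=.
  by rewrite -expr2 lerDl sumr_ge0// => k _; rewrite -expr2 sqr_ge0.
rewrite {1}vE mxE (le_trans (ler_norm_sum _ _ _))// [leRHS](bigD1 i)//=.
rewrite -[leLHS]addr0 lerD//; last first.
  by apply: sumr_ge0 => k _; apply: sumr_ge0.
by apply: ler_sum => k _; rewrite normrM ler_piMr.
Qed.

Lemma shell_orbit B xi : expanding B -> xi != 0 -> exists s, forall t,
  shell B ((expmx (t *: B))^T *m xi) <-> s < t < s + 1.
Proof.
move=> hB xi0; have [s hs] := flow_sqnorm_eq1 hB xi0.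
exists s => t.
rewrite /shell /= flow_sqnorm_shift -/(flow_sqnorm B xi t) -hs.
rewrite !(flow_sqnorm_lt _ _ hB xi0) ltrBlDr.
by split=> [[h1 h2]|/andP[h1 h2]]; [apply/andP|].
Qed.

End expanding_flow.

(** * One-parameter groups and their Haar measures *)

Section one_parameter_group.
Context {R : realType} {n : nat}.
Implicit Types (B X M A O D : 'M[R]_n) (t : R) (v w xi : 'cV[R]_n).

Lemma one_param_groupN B : one_param_group (- B) = one_param_group B.
Proof.
apply/seteqP; split => _ [t _ <-]; exists (- t) => //.
  by rewrite scaleNr scalerN.
by rewrite scaleNr scalerN opprK.
Qed.

Lemma eigenvalue_orthogonal_diag O D (i : 'I_n) : O *m O^T = 1%:M ->
  is_diag_mx D -> eigenvalue (O *m D *m O^T) (D i i).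
Proof.
move=> OO /is_diag_mxP dD.
have OO' : O^T *m O = 1%:M by exact: mulmx1C.
apply/eigenvalueP; exists (row i O^T).
  rewrite -row_mul !mulmxA OO' mul1mx; apply/rowP => j.
  rewrite !mxE (bigD1 i)//= big1 ?addr0 ?mxE// => k ki.
  by rewrite dD ?mul0r// eq_sym.
apply: contraTneq (oner_neq0 R) => h.
have := congr1 (fun X => X i i) OO'; rewrite !mxE eqxx mulr1n => <-.
rewrite big1 ?eqxx// => k _.
by have := congr1 (fun X : 'rV[R]_n => X 0 k) h; rewrite !mxE => ->; rewrite mul0r.
Qed.

Lemma expanding_pos M A : orthogonally_diagonalizable M ->
  (forall l : R, eigenvalue M l -> 0 < l) -> A^T = - A -> expanding (M + A).
Proof.
move=> [ O [ D [OO dD ME]]] hpos hA.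
(* a positive lower bound of the diagonal, also when [n = 0] *)
pose c := \big[Num.min/1]_i D i i.
have c0 : 0 < c.
  rewrite /c; apply: (big_ind (fun x : R => 0 < x)) => //; first by move=> x y x0 y0; rewrite lt_min x0.
  by move=> i _; apply: hpos; rewrite ME; exact: eigenvalue_orthogonal_diag.
have cD i : c <= D i i by exact: bigmin_le.
exists c => // v; pose w := O^T *m v.
have vA : dotv v (A *m v) = 0.
  have h : (v^T *m (A *m v))^T = - (v^T *m (A *m v)).
    by rewrite !trmx_mul trmxK hA mulmxN mulNmx mulmxA.
  have := congr1 (fun X : 'M[R]_1 => X 0 0) h.
  rewrite mxE [RHS]mxE -dotvE => /eqP.
  by rewrite -addr_eq0 -mulr2n mulrn_eq0 => /eqP.
have MT : M^T = M.
  rewrite ME !trmx_mul trmxK mulmxA; congr (_ *m _ *m _).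
  apply/matrixP => i j; rewrite mxE.
  have [->//|ij] := eqVneq i j.
  by move/is_diag_mxP: dD => dD; rewrite !dD// eq_sym.
have -> : dotv v ((M + A)^T *m v) = dotv v (M *m v).
  rewrite linearD /= MT hA mulmxDl mulNmx !dotvE mulmxDr mulmxN mxE [X in _ + X]mxE.
  by rewrite -dotvE -[X in _ - X]dotvE vA subr0.
have -> : dotv v (M *m v) = \sum_i D i i * (w i 0) ^+ 2.
  rewrite dotvE ME.
  have -> : v^T *m (O *m D *m O^T *m v) = w^T *m (D *m w).
    by rewrite /w trmx_mul trmxK !mulmxA.
  rewrite mxE; apply: eq_bigr => i _; rewrite [w^T 0 i]mxE [(D *m w) i 0]mxE.
  rewrite (bigD1 i)//= big1 ?addr0; first by rewrite expr2 mulrCA.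
  by move=> k ki; move/is_diag_mxP: dD => ->; rewrite ?mul0r// eq_sym.
have -> : dotv v v = \sum_i (w i 0) ^+ 2.
  transitivity (dotv w w); last by apply: eq_bigr => i _; rewrite expr2.
  by rewrite !dotvE /w trmx_mul trmxK mulmxA -(mulmxA v^T) OO mulmx1.
by rewrite mulr_sumr; apply: ler_sum => i _; rewrite ler_wpM2r ?sqr_ge0.
Qed.

Lemma expanding_or M A : orthogonally_diagonalizable M ->
  (forall l : R, eigenvalue M l -> 0 < l) \/
  (forall l : R, eigenvalue M l -> l < 0) -> A^T = - A ->
  expanding (M + A) \/ expanding (- (M + A)).
Proof.
move=> hM [h|h] hA; [left; exact: expanding_pos|right].
rewrite opprD; apply: expanding_pos.
- have [ O [ D [OO dD ME]]] := hM; exists O, (- D); split => //.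
    apply/is_diag_mxP => i j ij; rewrite mxE; move/is_diag_mxP: dD => -> //.
    by rewrite oppr0.
  by rewrite mulmxN mulNmx ME.
- move=> l /eigenvalueP[v vM v0]; rewrite -oppr_lt0; apply: h.
  apply/eigenvalueP; exists v => //.
  by rewrite scaleNr -vM mulmxN opprK.
- by rewrite linearN /= hA.
Qed.

Lemma compact_expmx_itv B a b : compact ((fun t => expmx (t *: B)) @` `[a, b]).
Proof.
apply: continuous_compact; last exact: segment_compact.
by apply: continuous_subspaceT; exact: continuous_expmx.
Qed.

Lemma closed_expmx_itv B a b : closed ((fun t => expmx (t *: B)) @` `[a, b]).
Proof.
by apply: compact_closed; [exact: norm_hausdorff|exact: compact_expmx_itv].
Qed.

(** Near an invertible matrix [a], the squared norm of [a^T *m xi] stays in a compact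
    subset of the positive reals, which confines [t] to a compact interval. *)
Lemma closed_subgroup_one_param B : expanding B ->
  closed_subgroup_GL (one_param_group B).
Proof.
move=> hB; split.
- by move=> _ [t _ <-]; exact: expmx_unit.
- by exists 0; rewrite // scale0r expmx0.
- by move=> _ _ [s _ <-] [t _ <-]; exists (s + t); rewrite // expmxD.
- by move=> _ [t _ <-]; exists (- t); rewrite // invmx_expmx.
move=> a aU acl.
have [[xi xi0]|noxi] := pselect (exists xi : 'cV[R]_n, xi != 0); last first.
  (* without nonzero vectors, [n = 0] and all matrices are equal *)
  have mx0 (b : 'M[R]_n) : b = 0.
    apply/matrixP => i j; have [h|h] := eqVneq (col j b) 0.
      by have := congr1 (fun v : 'cV[R]_n => v i 0) h; rewrite !mxE.
    by case: noxi; exists (col j b).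
  by exists 0 => //; rewrite (mx0 a) (mx0 (expmx _)).
have nz : 0 < dotv (a^T *m xi) (a^T *m xi).
  apply: dotv_gt0; apply: contra_neq xi0 => h.
  have u : a^T \in unitmx by rewrite unitmx_tr.
  by rewrite -[LHS](mulKmx u) h mulmx0.
set N := dotv (a^T *m xi) (a^T *m xi) in nz.
have [T1 T10 hT1] := flow_sqnorm_ge (N + 1) hB xi0.
have [T0 T00 hT0] := flow_sqnorm_le xi hB (divr_gt0 nz (@ltr0Sn R 1)).
pose K := (fun t => expmx (t *: B)) @` `[T0, T1].
suff : closure K a by move/(closed_expmx_itv (a := T0) (b := T1)) => [t _ <-]; exists t.
move=> V Va.
pose W := [set b : 'M[R]_n | N / 2 < dotv (b^T *m xi) (b^T *m xi) < N + 1].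
have Wa : nbhs a W.
  have cN := @continuous_dotv_trmul R n xi a.
  have : nbhs N [set x : R | N / 2 < x < N + 1].
    have : N \in `]N / 2, N + 1[.
      by rewrite in_itv /= ltrDl ltr01 andbT ltr_pdivrMr// ltr_pMr// ltr1n.
    by move=> /near_in_itvoo; apply: filterS => x; rewrite in_itv.
  by move/cN.
have [_ [[t _ <-] [Vb Wb]]] := acl _ (filterI Va Wa).
exists (expmx (t *: B)); split => //; exists t => //.
move: Wb; rewrite /W /= -/(flow_sqnorm B xi t) in_itv /= => /andP[h1 h2].
rewrite !leNgt -(flow_sqnorm_lt _ _ hB xi0) -(flow_sqnorm_lt T1 _ hB xi0).
apply/andP; split; rewrite -leNgt; first exact: le_trans hT0 (ltW h1).
exact: le_trans (ltW h2) hT1.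
Qed.

Lemma measurable_closed_mx m p (K : set 'M[R]_(m, p)) : closed K -> measurable K.
Proof.
move=> cK; rewrite -[K]setCK; apply: measurableC.
by apply: sub_sigma_algebra => /=; exact: closed_openC.
Qed.

(** The elements [exp (t B)] of the one-parameter group with [a < t < b]. *)
Definition expmx_arc B a b : set 'M[R]_n :=
  (fun t => expmx (t *: B)) @` `]a, b[.

Lemma measurable_expmx_arc B a b : measurable (expmx_arc B a b).
Proof.
rewrite /expmx_arc; have -> : (fun t => expmx (t *: B)) @` `]a, b[ = \bigcup_k
    ((fun t => expmx (t *: B)) @` `[a + k.+1%:R^-1, b - k.+1%:R^-1]).
  apply/seteqP; split=> [_ [t tab <-]|_ [k _ [t tab <-]]].
    move: tab; rewrite /= in_itv /= => /andP[at_ tb].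
    have e0 : 0 < Num.min (t - a) (b - t) by rewrite lt_min !subr_gt0 at_.
    have [k _ /(_ k (leqnn k))] := near_infty_natSinv_lt (PosNum e0).
    rewrite /= lt_min => /andP[h1 h2].
    exists k => //; exists t => //; rewrite /= in_itv /=.
    by move: (k.+1%:R^-1) h1 h2 => d h1 h2; apply/andP; split; lra.
  exists t => //; move: tab; rewrite /= !in_itv /=.
  have : 0 < k.+1%:R^-1 :> R by rewrite invr_gt0.
  by move: (k.+1%:R^-1) => d d0 /andP[h1 h2]; apply/andP; split; lra.
apply: bigcupT_measurable => k; apply: measurable_closed_mx.
exact: closed_expmx_itv.
Qed.

(** An enumeration of the half-integers. *)
Definition half_interval (k : nat) : R :=
  (odflt 0 (unpickle k : option int))%:~R / 2.

Lemma one_param_groupE B : one_param_group B =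
  \bigcup_k expmx_arc B (half_interval k) (half_interval k + 1).
Proof.
apply/seteqP; split=> [_ [t _ <-]|_ [k _ [t _ <-]]]; last by exists t.
(* the half-integer [z / 2] with [t - 1 < z / 2 <= t - 1 / 2] *)
exists (pickle (Num.floor (2 * t) - 1 : int)) => //; exists t => //.
rewrite /half_interval pickleK /= in_itv /= rmorphB /=.
have /andP[h1 h2] := real_floor_itv (num_real (2 * t)).
by move: h2; rewrite rmorphD /= => h2; apply/andP; split; lra.
Qed.

Lemma measurable_one_param_group B : measurable (one_param_group B).
Proof.
rewrite one_param_groupE; apply: bigcupT_measurable => k.
exact: measurable_expmx_arc.
Qed.

Section haar.
Variables (B : 'M[R]_n) (mu : {measure set 'M[R]_n -> \bar R}).
Hypothesis hmu : left_haar_measure (one_param_group B) mu.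

Lemma haar_expmx_arc s : mu (expmx_arc B s (s + 1)) =
  mu (expmx_arc B 0 1).
Proof.
have Gs : one_param_group B (expmx (s *: B)) by exists s.
rewrite -(haar_invariant hmu Gs (measurable_expmx_arc B 0 1)); congr (mu _).
apply/seteqP; split=> [_ [t tab <-]|_ [_ [t tab <-] <-]].
  exists (expmx ((t - s) *: B)); last by rewrite -expmxD addrC subrK.
  exists (t - s) => //; move: tab; rewrite /= !in_itv /= => /andP[h1 h2].
  by apply/andP; split; lra.
exists (s + t); last by rewrite expmxD.
by move: tab; rewrite /= !in_itv /= => /andP[h1 h2]; apply/andP; split; lra.
Qed.

Lemma haar_expmx_arc_lty : (mu (expmx_arc B 0%R 1%R) < +oo)%E.
Proof.
apply: (@le_lt_trans _ _ (mu ((fun t : R => expmx (t *: B)) @` `[(0 : R)%R, (1 : R)%R]))).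
  apply: le_measure; rewrite ?inE.
  - exact: measurable_expmx_arc.
  - by apply: measurable_closed_mx; exact: closed_expmx_itv.
  - by apply: image_subset; exact: subset_itv_oo_cc.
apply: haar_compact hmu _ _ _; first exact: compact_expmx_itv.
by move=> _ [t _ <-]; exists t.
Qed.

Lemma haar_expmx_arc_gt0 : (0 < mu (expmx_arc B 0%R 1%R))%E.
Proof.
rewrite lt_neqAle measure_ge0 andbT eq_sym.
apply: contra_neq (haar_neq0 hmu) => h.
apply: measure_negligible; first exact: measurable_one_param_group.
rewrite one_param_groupE; apply: negligible_bigcup => k.
by apply/negligibleP; [exact: measurable_expmx_arc|exact: etrans (haar_expmx_arc _) h].
Qed.

(** The constant value of Delta on the indicator function of the shell is the Haar
    measure of a unit arc, by left invariance. *)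
Lemma Delta_shell xi : expanding B -> xi != 0 ->
  let c := fine (mu (expmx_arc B 0 1)) in
  Delta (one_param_group B) mu
    (fun v => Complex ((Num.sqrt c)^-1 * \1_(shell B) v) 0) xi = 1%E.
Proof.
move=> hB xi0 c; have [s hs] := shell_orbit hB xi0.
have cE : mu (expmx_arc B 0 1) = c%:E.
  by rewrite /c fineK// ge0_fin_numE// haar_expmx_arc_lty.
have c0 : 0 < c by rewrite -lte_fin -cE haar_expmx_arc_gt0.
pose J := expmx_arc B s (s + 1).
transitivity (\int[mu]_(a in one_param_group B) ((c^-1)%:E * (\1_J a)%:E))%E.
  apply: eq_integral => a; rewrite inE => -[t _ <-].
  rewrite /= expr0n /= addr0 sqrtr_sqr real_normK ?num_real// exprMn exprVn.
  rewrite sqr_sqrtr ?(ltW c0)// -EFinM; congr (_ * _)%:E.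
  rewrite !indicE; have [h|h] := pselect (s < t < s + 1).
    rewrite !mem_set ?expr1n//; first by exists t => //=; rewrite in_itv.
    exact/hs.
  rewrite !memNset ?expr0n//; last by move/hs.
  move=> [u]; rewrite /= in_itv /= => hu uE; apply: h.
  by apply/hs; rewrite -uE; exact/hs.
rewrite ge0_integralZl_EFin//.
- rewrite integral_indic; [|exact: measurable_one_param_group|exact: measurable_expmx_arc].
  rewrite setIidl; last by move=> _ [t _ <-]; exists t.
  by rewrite haar_expmx_arc cE -EFinM mulVf// gt_eqF.
- exact: measurable_one_param_group.
- apply/measurable_EFinP; apply: measurable_indic; exact: measurable_expmx_arc.
- by rewrite invr_ge0 ltW.
Qed.

End haar.
End one_parameter_group.

(** * One-dimensional Laplace and Poisson integrals *)

Section one_dim.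
Context {R : realType}.
Notation mu := (@lebesgue_measure R).
Implicit Types (eps a b r t : R).

Lemma ge0_integralT_split (f : R -> R) c : (forall x, 0 <= f x) -> continuous f ->
  (\int[mu]_x (f x)%:E = \int[mu]_(x in `[c, +oo[) (f x)%:E
     + \int[mu]_(x in `[(- c)%R, +oo[) (f (- x))%:E)%E.
Proof.
move=> f0 cf.
have mf : measurable_fun setT f by exact: continuous_measurable_fun.
rewrite -(setUv `[c, +oo[%classic) ge0_integral_setU//=; last 4 first.
- exact: measurableC.
- by apply/measurable_EFinP; rewrite setUv.
- by move=> x _; rewrite lee_fin.
- exact/disj_setPCl.
congr (_ + _)%E; rewrite setCitvr.
rewrite integral_itv_bndo_bndc; last exact/measurable_EFinP/measurable_funTS.
rewrite -{1}(opprK c) ge0_integration_by_substitutionNy//.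
exact: continuous_subspaceT.
Qed.

(** A primitive of [t |-> exp (- eps t) (1 + cos (a t + b))]. Here and below the
    added [1] makes the integrands nonnegative, so that no integrability
    hypothesis is required. *)
Definition laplace_prim eps a b t : R := expR (- (eps * t)) *
  ((a * sin (a * t + b) - eps * cos (a * t + b)) / (eps ^+ 2 + a ^+ 2) - eps^-1).

Lemma is_derive_laplace_prim eps a b t : 0 < eps -> is_derive t (1 : R)
  (laplace_prim eps a b) (expR (- (eps * t)) * (1 + cos (a * t + b))).
Proof.
move=> e0.
have d1 : is_derive t (1 : R) (fun t => a * t + b) a.
  apply: (is_derive_eq (is_deriveD (is_deriveZ a (is_derive_id t (1 : R)))
    (is_derive_cst b t 1))).
  by rewrite /GRing.scale /= mulr1 addr0.
have d2 : is_derive t (1 : R) (fun t => - (eps * t)) (- eps).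
  apply: (is_derive_eq (is_deriveN (is_deriveZ eps (is_derive_id t (1 : R))))).
  by rewrite /GRing.scale /= mulr1.
have ds := is_derive1_comp (is_derive_sin _) d1.
have dc := is_derive1_comp (is_derive_cos _) d1.
have de := is_derive1_comp (is_derive_expR _) d2.
pose D := (eps ^+ 2 + a ^+ 2)^-1.
have dn := is_deriveB (is_deriveZ D (is_deriveB (is_deriveZ a ds) (is_deriveZ eps dc)))
   (is_derive_cst (eps^-1) t 1).
have := is_deriveM de dn.
have -> : (expR \o (fun t0 => - (eps * t0))) *
     (D *: (a *: (sin \o (fun t0 => a * t0 + b)) - eps *: (cos \o (fun t0 => a * t0 + b))) -
      cst eps^-1) = laplace_prim eps a b.
  apply/funext => x; rewrite /laplace_prim /= -/D !fctE /GRing.scale /=.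
  by rewrite [D * _]mulrC.
move=> h; apply: (is_derive_eq h).
have D0 : eps ^+ 2 + a ^+ 2 != 0.
  by rewrite gt_eqF// ltr_wpDr ?sqr_ge0// exprn_gt0.
rewrite !fctE /GRing.scale /= /GRing.scale /= /D; field.
by rewrite D0 gt_eqF.
Qed.

Lemma cvg_laplace_prim eps a b : 0 < eps ->
  laplace_prim eps a b t @[t --> +oo] --> (0 : R).
Proof.
move=> e0; pose C := (`|a| + eps) / (eps ^+ 2 + a ^+ 2) + eps^-1.
have D0 : 0 < eps ^+ 2 + a ^+ 2.
  by rewrite ltr_wpDr ?sqr_ge0// exprn_gt0.
have ce : expR (- (eps * t)) * C @[t --> +oo] --> (0 : R).
  rewrite -[X in _ --> X](mul0r C); apply: cvgMr_tmp.
  have h : eps * t @[t --> +oo] --> +oo.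
    by apply: gt0_cvgMry => //; exact: cvg_id.
  exact: (@cvg_comp _ _ _ _ (fun x : R => expR (- x)) _ _ _ h (@cvgr_expR R)).
apply/cvgr0Pnorm_le => e epos; near=> t.
have hC : `|laplace_prim eps a b t| <= expR (- (eps * t)) * C.
  rewrite /laplace_prim normrM ger0_norm ?expR_ge0// ler_wpM2l ?expR_ge0//.
  have ei : `|eps^-1| = eps^-1 by rewrite ger0_norm// invr_ge0 ltW.
  rewrite (le_trans (ler_normB _ _))// /C ei lerD2r.
  rewrite normrM [X in _ * X]ger0_norm ?invr_ge0 ?(ltW D0)//.
  rewrite ler_wpM2r ?invr_ge0 ?(ltW D0)// (le_trans (ler_normB _ _))// !normrM lerD//.
    by rewrite ler_piMr// ler_norml sin_geN1 sin_le1.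
  by rewrite (ger0_norm (ltW e0)) ler_piMr ?(ltW e0)// ler_norml cos_geN1 cos_le1.
apply: le_trans hC _; apply: le_trans (ler_norm _) _; near: t.
exact: (cvgr0_norm_le _ ce _ epos).
Unshelve. all: by end_near. Qed.

Lemma integral0y_laplace eps a b : 0 < eps ->
  (\int[mu]_(t in `[0%R, +oo[) (expR (- (eps * t)) * (1 + cos (a * t + b)))%:E =
  (eps^-1 + (eps * cos b - a * sin b) / (eps ^+ 2 + a ^+ 2))%:E)%E.
Proof.
move=> e0.
have dF t := is_derive_laplace_prim a b t e0.
have cF : continuous (laplace_prim eps a b).
  by move=> t; have [h _] := dF t; move/derivable1_diffP/differentiable_continuous: h.
rewrite (@ge0_continuous_FTC2y _ _ (laplace_prim eps a b) 0 0).
- rewrite -EFinD; congr EFin.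
  by rewrite /laplace_prim !mulr0 oppr0 expR0 !add0r mul1r; ring.
- by move=> t _; rewrite mulr_ge0 ?expR_ge0// -lerBlDl sub0r cos_geN1.
- apply: continuous_subspaceT => t; apply: cvgM.
    apply: continuous_comp; last exact: continuous_expR.
    by apply: cvgN; apply: cvgMl_tmp; exact: cvg_id.
  apply: cvgD; first exact: cvg_cst.
  apply: continuous_comp; last exact: continuous_cos.
  apply: cvgD; last exact: cvg_cst.
  by apply: cvgMl_tmp; exact: cvg_id.
- exact: cvg_laplace_prim.
- by move=> t _; case: (dF t).
- by apply: cvg_at_right_filter; exact: cF.
- by move=> t _; rewrite derive1E; have := dF t => h; rewrite derive_val.
Qed.

Lemma integralT_laplace eps a b : 0 < eps ->
  (\int[mu]_t (expR (- (eps * `|t|)) * (1 + cos (a * t + b)))%:E =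
  (2 / eps + cos b * (2 * eps / (eps ^+ 2 + a ^+ 2)))%:E)%E.
Proof.
move=> e0; rewrite (@ge0_integralT_split _ 0).
- rewrite oppr0.
  have -> : (\int[mu]_(t in `[0%R, +oo[) (expR (- (eps * `|t|)) * (1 + cos (a * t + b)))%:E =
     \int[mu]_(t in `[0%R, +oo[) (expR (- (eps * t)) * (1 + cos (a * t + b)))%:E)%E.
    apply: eq_integral => t; rewrite inE /= in_itv /= andbT => t0.
    by rewrite ger0_norm.
  have -> : (\int[mu]_(t in `[0%R, +oo[) (expR (- (eps * `|- t|)) * (1 + cos (a * (- t) + b)))%:E =
     \int[mu]_(t in `[0%R, +oo[) (expR (- (eps * t)) * (1 + cos ((- a) * t + b)))%:E)%E.
    apply: eq_integral => t; rewrite inE /= in_itv /= andbT => t0.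
    by rewrite normrN ger0_norm// mulrN mulNr.
  rewrite !integral0y_laplace// -EFinD; congr EFin.
  rewrite sqrrN; field.
  by rewrite !gt_eqF// ltr_wpDr ?sqr_ge0// exprn_gt0.
- by move=> t; rewrite mulr_ge0 ?expR_ge0// -lerBlDl sub0r cos_geN1.
- move=> t; apply: cvgM.
    apply: continuous_comp; last exact: continuous_expR.
    by apply: cvgN; apply: cvgMl_tmp; exact: norm_continuous.
  apply: cvgD; first exact: cvg_cst.
  apply: continuous_comp; last exact: continuous_cos.
  apply: cvgD; last exact: cvg_cst.
  by apply: cvgMl_tmp; exact: cvg_id.
Qed.

(** The Fourier transform of [t |-> exp (- eps |t|)]. *)
Definition poisson eps t : R := 2 * eps / (eps ^+ 2 + (2 * pi * t) ^+ 2).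

Lemma poisson_den_gt0 eps t : 0 < eps -> 0 < eps ^+ 2 + (2 * pi * t) ^+ 2.
Proof. by move=> e0; rewrite ltr_wpDr ?sqr_ge0// exprn_gt0. Qed.

Lemma poisson_gt0 eps t : 0 < eps -> 0 < poisson eps t.
Proof. by move=> e0; rewrite divr_gt0 ?poisson_den_gt0// mulr_gt0. Qed.

Lemma poissonN eps t : poisson eps (- t) = poisson eps t.
Proof. by rewrite /poisson mulrN sqrrN. Qed.

Lemma continuous_poisson eps : 0 < eps -> continuous (poisson eps).
Proof.
move=> e0 t; apply: cvgMl_tmp; apply: cvgV; first by rewrite gt_eqF// poisson_den_gt0.
apply: cvgD; first exact: cvg_cst.
apply: (@cvg_comp _ _ _ (fun t : R => 2 * pi * t) (fun x : R => x ^+ 2)).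
  by apply: cvgMl_tmp; exact: cvg_id.
exact: exprn_continuous.
Qed.

(** A primitive of the Poisson kernel centered at [c]. *)
Definition poisson_prim eps c t : R := pi^-1 * atan (2 * pi / eps * (t - c)).

Lemma is_derive_poisson_prim eps c t : 0 < eps -> is_derive t (1 : R)
  (poisson_prim eps c) (poisson eps (t - c)).
Proof.
move=> e0.
have d1 : is_derive t (1 : R) (fun t => 2 * pi / eps * (t - c)) (2 * pi / eps).
  have h := is_deriveB (is_derive_id t (1 : R)) (is_derive_cst c t (1 : R)).
  apply: (is_derive_eq (is_deriveZ (2 * pi / eps) h)).
  by rewrite /GRing.scale /= subr0 mulr1.
have da := is_deriveZ (pi^-1) (is_derive1_comp (is_derive1_atan _) d1).
apply: (is_derive_eq da).
have p0 : pi != 0 :> R by rewrite gt_eqF// pi_gt0.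
have := poisson_den_gt0 (t - c) e0.
rewrite /GRing.scale /= /poisson; move: (@pi R) p0 (t - c) => p p0 u h.
by field; rewrite p0 !gt_eqF.
Qed.

Lemma continuous_poisson_prim eps c : 0 < eps -> continuous (poisson_prim eps c).
Proof.
move=> e0 t; have [h _] := is_derive_poisson_prim c t e0.
by move/derivable1_diffP/differentiable_continuous: h.
Qed.

Lemma continuous_poissonB eps c : 0 < eps -> continuous (fun t => poisson eps (t - c)).
Proof.
move=> e0 t; apply: (@cvg_comp _ _ _ (fun t : R => t - c) (poisson eps)).
  by apply: cvgB; [exact: cvg_id|exact: cvg_cst].
exact: continuous_poisson.
Qed.

Lemma integralcy_poisson eps c : 0 < eps ->
  (\int[mu]_(t in `[c, +oo[) (poisson eps (t - c))%:E = (2^-1)%:E)%E.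
Proof.
move=> e0.
have p0 : 0 < pi :> R by rewrite pi_gt0.
rewrite (@ge0_continuous_FTC2y _ _ (poisson_prim eps c) c 2^-1).
- by rewrite /poisson_prim subrr mulr0 atan0 mulr0 sube0.
- by move=> t _; rewrite ltW// poisson_gt0.
- by apply: continuous_subspaceT; exact: continuous_poissonB.
- have -> : 2^-1 = pi^-1 * (pi / 2) :> R by rewrite mulKf// gt_eqF.
  apply: cvgMl_tmp.
  apply: (@cvg_comp _ _ _ (fun t : R => 2 * pi / eps * (t - c)) (@atan R) _ (+oo));
    last exact: cvgy_atan.
  apply: gt0_cvgMry; first by rewrite divr_gt0// mulr_gt0.
  by apply: cvg_addrr; exact: cvg_id.
- by move=> t _; case: (is_derive_poisson_prim c t e0).
- by apply: cvg_at_right_filter; exact: continuous_poisson_prim.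
- by move=> t _; rewrite derive1E; have h := is_derive_poisson_prim c t e0; rewrite derive_val.
Qed.

Lemma integralT_poisson eps c : 0 < eps ->
  (\int[mu]_t (poisson eps (t - c))%:E = 1)%E.
Proof.
move=> e0; rewrite (@ge0_integralT_split _ c).
- under [X in (_ + X)%E]eq_integral do
    rewrite -opprD poissonN -[X in _ + X]opprK.
  rewrite !integralcy_poisson// -EFinD; congr EFin; lra.
- by move=> t; rewrite ltW// poisson_gt0.
- exact: continuous_poissonB.
Qed.

Lemma integral_poisson_itv eps c r : 0 < eps -> 0 < r ->
  (\int[mu]_(t in `](c - r)%R, (c + r)%R[) (poisson eps (t - c))%:E =
   (2 / pi * atan (2 * pi / eps * r))%:E)%E.
Proof.
move=> e0 r0.
have mp : measurable_fun setT (fun t => poisson eps (t - c)).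
  by apply: continuous_measurable_fun; exact: continuous_poissonB.
rewrite integral_itv_bndo_bndc; last exact/measurable_EFinP/measurable_funTS.
rewrite integral_itv_obnd_cbnd; last exact/measurable_EFinP/measurable_funTS.
rewrite (@continuous_FTC2 _ _ (poisson_prim eps c)).
- rewrite /poisson_prim -EFinB; congr EFin.
  have -> : c + r - c = r by ring.
  have -> : c - r - c = - r by ring.
  by rewrite mulrN atanN; ring.
- lra.
- by apply: continuous_subspaceT; exact: continuous_poissonB.
- split; [move=> t _; by case: (is_derive_poisson_prim c t e0)| |].
  + by apply: cvg_at_right_filter; exact: continuous_poisson_prim.
  + by apply: cvg_at_left_filter; exact: continuous_poisson_prim.
- by move=> t _; rewrite derive1E; have h := is_derive_poisson_prim c t e0; rewrite derive_val.
Qed.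

End one_dim.

(** * Iterated integrals on column vectors *)

Section integral_cV.
Context {R : realType}.
Notation leb := (@lebesgue_measure R).

Lemma measurable_coord_cV n (i : 'I_n) : measurable_fun setT (fun v : 'cV[R]_n => v i 0).
Proof.
have h := @measurable_id _ 'cV[R]_n setT.
exact: (proj1 (measurable_fun_mxP _) h).
Qed.

(** Tonelli's theorem for the splitting of the first coordinate. *)
Lemma ge0_integral_lebesgue_cVS n (f : 'cV[R]_n.+1 -> \bar R) :
  measurable_fun setT f -> (forall x, 0 <= f x)%E ->
  (\int[lebesgue_cV n.+1]_x f x =
   \int[lebesgue_cV n]_v \int[leb]_t f (cons_cV (t, v)))%E.
Proof.
move=> mf f0.
have mc := @measurable_cons_cV R n.
transitivity (\int[pushforward (leb \x lebesgue_cV n)%E cons_cV]_x f x)%E => //.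
rewrite ge0_integral_pushforward// preimage_setT.
have mfc : measurable_fun setT (f \o @cons_cV R n) by exact: measurableT_comp.
by apply: (@fubini_tonelli2 _ _ _ _ _ leb (lebesgue_cV n) _ mfc) => x; exact: f0.
Qed.

Lemma integral_lebesgue_cV0 (f : 'cV[R]_0 -> \bar R) :
  measurable_fun setT f -> (\int[lebesgue_cV 0]_x f x = f 0%R)%E.
Proof.
move=> mf; transitivity (\int[\d_(0%R : 'cV[R]_0)]_x f x)%E => //.
by rewrite integral_dirac// diracT mul1e.
Qed.

Lemma integral_prod_cV n (k : 'I_n -> R -> R) (c : 'I_n -> R) :
  (forall i t, 0 <= k i t) -> (forall i, measurable_fun setT (k i)) ->
  (forall i, \int[leb]_t (k i t)%:E = (c i)%:E)%E ->
  (\int[lebesgue_cV n]_x (\prod_i k i (x i 0))%:E = (\prod_i c i)%:E)%E.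
Proof.
have mprod m (k' : 'I_m -> R -> R) : (forall i, measurable_fun setT (k' i)) ->
    measurable_fun setT (fun x : 'cV[R]_m => \prod_i k' i (x i 0)).
  move=> mk; apply: measurable_prod => i _.
  by apply: measurableT_comp => //; exact: measurable_coord_cV.
elim: n k c => [|n IH] k c k0 mk hk.
  rewrite integral_lebesgue_cV0; first by rewrite !big_ord0.
  by apply/measurable_EFinP; exact: mprod.
rewrite ge0_integral_lebesgue_cVS; last 2 first.
  by apply/measurable_EFinP; exact: mprod.
  by move=> x; rewrite lee_fin prodr_ge0.
transitivity (\int[lebesgue_cV n]_v ((c ord0)%:E *
    (\prod_i k (lift ord0 i) (v i 0))%:E))%E.
  apply: eq_integral => v _.
  rewrite -hk muleC -ge0_integralZl//.
  - apply: eq_integral => t _; rewrite -EFinM big_ord_recl cons_cV0 mulrC.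
    by congr (_ * _)%:E; apply: eq_bigr => i _; rewrite cons_cVS.
  - by apply/measurable_EFinP; exact: mk.
  - by move=> t _; rewrite lee_fin.
  - by rewrite lee_fin prodr_ge0.
rewrite ge0_integralZl//.
- by rewrite (IH (fun i => k (lift ord0 i)) (fun i => c (lift ord0 i)))// -EFinM big_ord_recl.
- by apply/measurable_EFinP; apply: (mprod _ (fun i => k (lift ord0 i))).
- by move=> v _; rewrite lee_fin prodr_ge0.
- by rewrite -hk integral_ge0// => t _; rewrite lee_fin.
Qed.

(** The damping factor [exp (- eps \sum_i |v_i|)]. *)
Definition damp n (eps : R) (v : 'cV[R]_n) : R :=
  \prod_i expR (- (eps * `|v i 0|)).

Lemma damp_gt0 n eps (v : 'cV[R]_n) : 0 < damp eps v.
Proof. by apply: prodr_gt0 => i _; exact: expR_gt0. Qed.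

Lemma measurable_damp n eps : measurable_fun setT (@damp n eps).
Proof.
apply: measurable_prod => i _; apply: measurableT_comp => //.
apply: measurableT_comp => //; apply: measurable_funM => //.
by apply: measurableT_comp => //; exact: measurable_coord_cV.
Qed.

Lemma damp_cos_pihalf n eps (x : 'cV[R]_n) :
  damp eps x * (1 + cos (dotv x 0 + pi / 2)) = damp eps x.
Proof.
have -> : dotv x 0 + pi / 2 = pi / 2.
  by rewrite /dotv big1 ?add0r// => i _; rewrite mxE mulr0.
by rewrite cos_pihalf addr0 mulr1.
Qed.

Lemma measurable_dotv n (w : 'cV[R]_n) : measurable_fun setT (dotv^~ w).
Proof.
apply: measurable_sum => i; apply: measurable_funM => //.
exact: measurable_coord_cV.
Qed.

Lemma measurable_cosT : measurable_fun setT (@cos R).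
Proof. by apply: continuous_measurable_fun; exact: continuous_cos. Qed.

(** The Fourier transform of the damping factor, by induction on the dimension. The
    phase [b] makes the statement inductive: the inner integration of one
    coordinate absorbs the others in the phase. *)
Lemma integral_damp_cos n (eps : R) (w : 'cV[R]_n) b : 0 < eps ->
  (\int[lebesgue_cV n]_x (damp eps x * (1 + cos (dotv x w + b)))%:E =
   ((2 / eps) ^+ n + cos b * \prod_i (2 * eps / (eps ^+ 2 + (w i 0) ^+ 2)))%:E)%E.
Proof.
move=> e0.
have mG m (u : 'cV[R]_m) d : measurable_fun setT
    (fun x => damp eps x * (1 + cos (dotv x u + d))).
  apply: measurable_funM; first exact: measurable_damp.
  apply: measurable_funD => //; apply: (measurableT_comp measurable_cosT).
  by apply: measurable_funD => //; exact: measurable_dotv.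
have G0 m (x u : 'cV[R]_m) d : 0 <= damp eps x * (1 + cos (dotv x u + d)).
  by rewrite mulr_ge0 ?(ltW (damp_gt0 _ _))// -lerBlDl sub0r cos_geN1.
elim: n w b => [|n IH] w b.
  rewrite integral_lebesgue_cV0; last by apply/measurable_EFinP; exact: mG.
  by rewrite /damp /dotv !big_ord0 expr0 mulr1 mul1r add0r.
rewrite ge0_integral_lebesgue_cVS; last 2 first.
  by apply/measurable_EFinP; exact: mG.
  by move=> x; rewrite lee_fin.
pose P := 2 * eps / (eps ^+ 2 + (w ord0 0) ^+ 2).
pose w' := \col_i w (lift ord0 i) 0.
have P0 : 0 <= P.
  by rewrite divr_ge0 ?mulr_ge0 ?addr_ge0 ?sqr_ge0// ltW.
have Pe : 0 <= 2 / eps - P.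
  rewrite subr_ge0 /P ler_pdivrMr; last by rewrite ltr_wpDr ?sqr_ge0// exprn_gt0.
  rewrite mulrDr -subr_ge0.
  have -> : 2 / eps * eps ^+ 2 + 2 / eps * w ord0 0 ^+ 2 - 2 * eps =
     2 / eps * w ord0 0 ^+ 2 by field; rewrite gt_eqF.
  by rewrite mulr_ge0 ?sqr_ge0// divr_ge0// ltW.
(* the integral over the first coordinate, as a combination with nonnegative
   coefficients of two instances of the induction hypothesis *)
transitivity (\int[lebesgue_cV n]_v (
   (2 / eps - P)%:E * (damp eps v * (1 + cos (dotv v 0 + pi / 2)))%:E
   + P%:E * (damp eps v * (1 + cos (dotv v w' + b)))%:E))%E.
  apply: eq_integral => v _.
  transitivity (\int[leb]_t ((damp eps v)%:E *
     (expR (- (eps * `|t|)) * (1 + cos (w ord0 0 * t + (dotv v w' + b))))%:E))%E.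
    apply: eq_integral => t _; rewrite -EFinM; congr EFin.
    rewrite /damp /dotv !big_ord_recl cons_cV0 [RHS]mulrA; congr (_ * (1 + cos _)).
    - by rewrite mulrC; congr (_ * _); apply: eq_bigr => i _; rewrite cons_cVS.
    - rewrite addrA mulrC; congr (_ + _ + _).
      by apply: eq_bigr => i _; rewrite cons_cVS mxE.
  rewrite ge0_integralZl//.
  - rewrite integralT_laplace// -!EFinM -EFinD; congr EFin.
    by rewrite damp_cos_pihalf -/P; ring.
  - apply/measurable_EFinP; apply: measurable_funM.
      apply: measurableT_comp => //; apply: measurableT_comp => //.
      by apply: measurable_funM => //; exact: measurable_normr.
    apply: measurable_funD => //; apply: (measurableT_comp measurable_cosT).
    by apply: measurable_funD => //; apply: measurable_funM.
  - by rewrite lee_fin ltW// damp_gt0.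
rewrite ge0_integralD//; last 4 first.
- by move=> v _; rewrite mule_ge0// lee_fin.
- by apply: measurable_funeM; by apply/measurable_EFinP; exact: mG.
- by move=> v _; rewrite mule_ge0// lee_fin.
- by apply: measurable_funeM; by apply/measurable_EFinP; exact: mG.
rewrite !ge0_integralZl_EFin//; last 4 first.
- by move=> v _; rewrite lee_fin.
- by apply/measurable_EFinP; exact: mG.
- by move=> v _; rewrite lee_fin.
- by apply/measurable_EFinP; exact: mG.
rewrite !IH -!EFinM -EFinD; congr EFin.
rewrite cos_pihalf mul0r addr0 big_ord_recl -/P (exprS (2 / eps)).
have -> : \prod_i (2 * eps / (eps ^+ 2 + w' i 0 ^+ 2)) =
    \prod_i (2 * eps / (eps ^+ 2 + w (lift ord0 i) 0 ^+ 2)).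
  by apply: eq_bigr => i _; rewrite mxE.
by ring.
Qed.

End integral_cV.

(** * Integrability by domination and the Fubini theorem *)

Section integrable_domination.
Context d (T : measurableType d) (R : realType).
Variable mu : {measure set T -> \bar R}.
Implicit Types f g : T -> R.

Lemma integrable_dom f g : measurable_fun setT f -> (forall x, `|f x| <= g x) ->
  mu.-integrable setT (EFin \o g) -> mu.-integrable setT (EFin \o f).
Proof.
move=> mf fg; apply: le_integrable => //; first exact/measurable_EFinP.
by move=> x _ /=; rewrite lee_fin (le_trans (fg x))// ler_norm.
Qed.

Lemma ge0_integrable f : measurable_fun setT f -> (forall x, 0 <= f x) ->
  (\int[mu]_x (f x)%:E < +oo)%E -> mu.-integrable setT (EFin \o f).
Proof.
move=> mf f0 foo; apply/integrableP; split; first exact/measurable_EFinP.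
by under eq_integral do rewrite /= ger0_norm ?f0//.
Qed.

Lemma integrable_scale (r : R) f : mu.-integrable setT (EFin \o f) ->
  mu.-integrable setT (EFin \o (fun x => r * f x)).
Proof. by move=> h; exact: (integrableZl measurableT r h). Qed.

Lemma EFin_Rintegral f : mu.-integrable setT (EFin \o f) ->
  (\int[mu]_x f x)%:E = (\int[mu]_x (f x)%:E)%E.
Proof. by move=> h; rewrite fineK//; exact: integrable_fin_num. Qed.

Lemma Rintegral_EFin f r : (\int[mu]_x (f x)%:E = r%:E)%E -> \int[mu]_x f x = r.
Proof. by rewrite /Rintegral => ->. Qed.

Lemma Rintegral_norm_le f g : measurable_fun setT f -> (forall x, `|f x| <= g x) ->
  mu.-integrable setT (EFin \o g) -> `|\int[mu]_x f x| <= \int[mu]_x g x.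
Proof.
move=> mf fg ig; have jf := integrable_dom mf fg ig.
apply: le_trans (le_normr_Rintegral measurableT jf) _.
apply: le_Rintegral => //; apply: integrable_dom ig.
  exact: measurableT_comp.
by move=> x; rewrite normr_id.
Qed.

End integrable_domination.

Section fubini_domination.
Context d1 d2 (T1 : measurableType d1) (T2 : measurableType d2) (R : realType).
Variable m1 : {sigma_finite_measure set T1 -> \bar R}.
Variable m2 : {sigma_finite_measure set T2 -> \bar R}.
Variables (h : T1 * T2 -> R) (u : T1 -> R) (w : T2 -> R).
Hypothesis mh : measurable_fun setT h.
Hypothesis hu : forall x y, `|h (x, y)| <= u x * w y.
Hypothesis u0 : forall x, 0 <= u x.
Hypothesis w0 : forall y, 0 <= w y.
Hypothesis iu : m1.-integrable setT (EFin \o u).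
Hypothesis iw : m2.-integrable setT (EFin \o w).

Lemma integrable_prod_dom : (m1 \x m2)%E.-integrable setT (EFin \o h).
Proof.
have mhE : measurable_fun setT (EFin \o h) by exact/measurable_EFinP.
have mu' : measurable_fun setT u by case/integrableP: iu => /measurable_EFinP.
have mw' : measurable_fun setT w by case/integrableP: iw => /measurable_EFinP.
apply/integrable12ltyP => //.
pose W := \int[m2]_y w y.
have WE : (\int[m2]_y (w y)%:E = W%:E)%E by rewrite /W EFin_Rintegral.
have W0 : 0 <= W by apply: Rintegral_ge0.
apply: (@le_lt_trans _ _ (\int[m1]_x (W%:E * (u x)%:E))%E); last first.
  rewrite ge0_integralZl_EFin//.
  - by rewrite -EFin_Rintegral// -EFinM ltry.
  - by move=> x _; rewrite lee_fin.
  - exact/measurable_EFinP.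
apply: ge0_le_integral => //.
- by move=> x _; exact: integral_ge0.
- apply: (measurable_fun_fubini_tonelli_F (abse \o (EFin \o h))) => //=.
  exact: measurableT_comp.
- by apply: measurable_funeM; exact/measurable_EFinP.
move=> x _; rewrite -WE muleC -ge0_integralZl_EFin//.
- apply: ge0_le_integral => //.
  + apply: measurableT_comp => //; apply/measurable_EFinP.
    by apply: (measurableT_comp mh); exact: measurable_pair1.
  + by apply: measurable_funeM; exact/measurable_EFinP.
  + by move=> y _; rewrite -EFinM lee_fin hu.
- by move=> y _; rewrite lee_fin.
- exact/measurable_EFinP.
Qed.

Lemma integrable_section1 x : m2.-integrable setT (EFin \o (fun y => h (x, y))).
Proof.
apply: (@integrable_dom _ _ _ _ _ (fun y => u x * w y)).
- by apply: (measurableT_comp mh); exact: measurable_pair1.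
- by move=> y; exact: hu.
- exact: integrable_scale.
Qed.

Lemma integrable_section2 y : m1.-integrable setT (EFin \o (fun x => h (x, y))).
Proof.
apply: (@integrable_dom _ _ _ _ _ (fun x => w y * u x)).
- by apply: (measurableT_comp mh); exact: measurable_pair2.
- by move=> x; rewrite mulrC; exact: hu.
- exact: integrable_scale.
Qed.

(** Fubini's theorem for a function dominated by a product. *)
Lemma Rfubini_dom : \int[m1]_x (\int[m2]_y h (x, y)) =
  \int[m2]_y (\int[m1]_x h (x, y)).
Proof.
rewrite /Rintegral; congr fine.
under eq_integral do rewrite EFin_Rintegral ?integrable_section1//.
under [RHS]eq_integral do rewrite EFin_Rintegral ?integrable_section2//.
exact: (Fubini integrable_prod_dom).
Qed.

End fubini_domination.

(** * Damping factors and the product Poisson kernel *)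

Section damped_kernel.
Context {R : realType} {n : nat}.
Notation lam := (@lebesgue_cV R n).
Implicit Types (x xi eta w : 'cV[R]_n) (eps b : R).

Lemma integrable_damp eps : 0 < eps -> lam.-integrable setT (EFin \o damp eps).
Proof.
move=> e0; apply: ge0_integrable; first exact: measurable_damp.
  by move=> x; rewrite ltW// damp_gt0.
have <- : (\int[lam]_x (damp eps x * (1 + cos (dotv x 0 + pi / 2)))%:E =
           \int[lam]_x (damp eps x)%:E)%E.
  by apply: eq_integral => x _; rewrite damp_cos_pihalf.
by rewrite integral_damp_cos// ltry.
Qed.

Lemma measurable_cos_dotv w b : measurable_fun setT (fun x => cos (dotv x w + b)).
Proof.
apply: (measurableT_comp measurable_cosT).
by apply: measurable_funD => //; exact: measurable_dotv.
Qed.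

Lemma norm_damp_cos eps x w b : `|damp eps x * cos (dotv x w + b)| <= damp eps x.
Proof.
rewrite normrM ger0_norm ?ler_piMr ?(ltW (damp_gt0 _ _))//.
by rewrite ler_norml cos_geN1 cos_le1.
Qed.

Lemma integrable_damp_cos eps w b : 0 < eps ->
  lam.-integrable setT (EFin \o (fun x => damp eps x * cos (dotv x w + b))).
Proof.
move=> e0; apply: (@integrable_dom _ _ _ _ _ (damp eps)).
- apply: measurable_funM; [exact: measurable_damp|exact: measurable_cos_dotv].
- by move=> x; exact: norm_damp_cos.
- exact: integrable_damp.
Qed.

Lemma Rintegral_damp eps : 0 < eps -> \int[lam]_x damp eps x = (2 / eps) ^+ n.
Proof.
move=> e0; apply: Rintegral_EFin.
have <- : (\int[lam]_x (damp eps x * (1 + cos (dotv x 0 + pi / 2)))%:E =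
           \int[lam]_x (damp eps x)%:E)%E.
  by apply: eq_integral => x _; rewrite damp_cos_pihalf.
by rewrite integral_damp_cos// cos_pihalf mul0r addr0.
Qed.

Lemma Rintegral_damp_cos eps w b : 0 < eps ->
  \int[lam]_x (damp eps x * cos (dotv x w + b)) =
  cos b * \prod_i (2 * eps / (eps ^+ 2 + (w i 0) ^+ 2)).
Proof.
move=> e0; have := Rintegral_EFin (integral_damp_cos w b e0).
under eq_Rintegral do rewrite mulrDr mulr1.
rewrite RintegralD//; [|exact: integrable_damp|exact: integrable_damp_cos].
by rewrite Rintegral_damp// => /addrI.
Qed.

(** The product Poisson kernel, Fourier transform of [damp eps]. *)
Definition poisson_mx eps x : R := \prod_i poisson eps (x i 0).

Lemma poisson_mx_ge0 eps x : 0 < eps -> 0 <= poisson_mx eps x.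
Proof. by move=> e0; apply: prodr_ge0 => i _; rewrite ltW// poisson_gt0. Qed.

Lemma poisson_mxN eps x : poisson_mx eps (- x) = poisson_mx eps x.
Proof. by apply: eq_bigr => i _; rewrite mxE poissonN. Qed.

Lemma poisson_mxB eps x y : poisson_mx eps (x - y) = poisson_mx eps (y - x).
Proof. by rewrite -poisson_mxN opprB. Qed.

Lemma measurable_poisson eps : 0 < eps -> measurable_fun setT (@poisson R eps).
Proof. by move=> e0; apply: continuous_measurable_fun; exact: continuous_poisson. Qed.

Lemma measurable_poisson_mxB eps eta : 0 < eps ->
  measurable_fun setT (fun x => poisson_mx eps (x - eta)).
Proof.
move=> e0; apply: measurable_prod => i _.
apply: (measurableT_comp (measurable_poisson e0)).
under eq_fun do rewrite !mxE.
by apply: measurable_funB => //; exact: measurable_coord_cV.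
Qed.

Lemma integral_poisson_mx eps eta : 0 < eps ->
  (\int[lam]_x (poisson_mx eps (x - eta))%:E = 1)%E.
Proof.
move=> e0.
have h : (\int[lam]_x (\prod_i poisson eps (x i 0 - eta i 0))%:E =
  (\prod_(i < n) (1 : R))%:E)%E.
  apply: (integral_prod_cV (k := fun i t => poisson eps (t - eta i 0))).
  - by move=> i t; rewrite ltW// poisson_gt0.
  - move=> i; apply: continuous_measurable_fun; exact: continuous_poissonB.
  - by move=> i; exact: integralT_poisson.
rewrite big1// in h; rewrite -h.
by apply: eq_integral => x _; congr EFin; apply: eq_bigr => i _; rewrite !mxE.
Qed.

Lemma integrable_poisson_mx eps eta : 0 < eps ->
  lam.-integrable setT (EFin \o (fun x => poisson_mx eps (x - eta))).
Proof.
move=> e0; apply: ge0_integrable; first exact: measurable_poisson_mxB.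
  by move=> x; exact: poisson_mx_ge0.
by rewrite integral_poisson_mx// ltry.
Qed.

(** The open cube of center [eta] and half-side [r]. *)
Definition box eta (r : R) : set 'cV[R]_n := [set x | forall i, `|x i 0 - eta i 0| < r].

Lemma indic_box eta r x : \1_(box eta r) x =
  \prod_i \1_`]eta i 0 - r, eta i 0 + r[ (x i 0) :> R.
Proof.
have itvE i : (x i 0 \in `](eta i 0 - r), (eta i 0 + r)[) = (`|x i 0 - eta i 0| < r).
  by rewrite in_itv /= ltr_norml; apply/andP/andP => -[h1 h2]; split; lra.
have [h|h] := pselect (box eta r x); rewrite indicE; [rewrite mem_set//|rewrite memNset//=].
  rewrite big1// => i _; rewrite indicE mem_set//=.
  by rewrite itvE.
have [i hi] : exists i, ~ (`|x i 0 - eta i 0| < r) by exact/existsNP.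
rewrite (bigD1 i)//= indicE memNset ?mul0r//= itvE.
exact: hi.
Qed.

Lemma integral_poisson_box eps eta r : 0 < eps -> 0 < r ->
  (\int[lam]_x (poisson_mx eps (x - eta) * \1_(box eta r) x)%:E =
   ((2 / pi * atan (2 * pi / eps * r)) ^+ n)%:E)%E.
Proof.
move=> e0 r0.
pose k (i : 'I_n) t : R := poisson eps (t - eta i 0) * \1_`]eta i 0 - r, eta i 0 + r[ t.
have h : (\int[lam]_x (\prod_i k i (x i 0))%:E =
  (\prod_(i < n) (2 / pi * atan (2 * pi / eps * r)))%:E)%E.
  apply: integral_prod_cV.
  - by move=> i t; rewrite mulr_ge0// ltW// poisson_gt0.
  - move=> i; apply: measurable_funM; last exact: measurable_indic.
    apply: continuous_measurable_fun; exact: continuous_poissonB.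
  - move=> i; rewrite -(integral_poisson_itv (eta i 0) e0 r0) [RHS]integral_mkcond.
    apply: eq_integral => t _; rewrite patchE /k indicE.
    by case: ifPn => _; rewrite ?mulr1 ?mulr0.
rewrite prodr_const card_ord in h; rewrite -h.
apply: eq_integral => x _; congr EFin; rewrite indic_box -big_split /=.
by apply: eq_bigr => i _; rewrite /k !mxE.
Qed.

Lemma measurable_box eta r : measurable (box eta r).
Proof.
have -> : box eta r = \bigcap_(i in [set: 'I_n])
    ((fun x : 'cV[R]_n => x i 0) @^-1` `]eta i 0 - r, eta i 0 + r[).
  apply/seteqP; split => x /=.
    move=> h i _ /=; have := h i; rewrite in_itv /= ltr_norml => /andP[h1 h2].
    by apply/andP; split; lra.
  move=> h i; have := h i Logic.I; rewrite /= in_itv /= ltr_norml => /andP[h1 h2].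
  by apply/andP; split; lra.
apply: fin_bigcap_measurable => // i _.
by rewrite -[X in measurable X]setTI; apply: measurable_coord_cV.
Qed.

Lemma box_lty eta r : 0 < r -> (lam (box eta r) < +oo)%E.
Proof.
move=> r0.
pose k (i : 'I_n) t : R := \1_`]eta i 0 - r, eta i 0 + r[ t.
have h : (\int[lam]_x (\prod_i k i (x i 0))%:E = (\prod_(i < n) (2 * r))%:E)%E.
  apply: integral_prod_cV.
  - by move=> i t.
  - by move=> i; exact: measurable_indic.
  - move=> i; rewrite integral_indic// setIT. rewrite [LHS]lebesgue_measure_itv /= lte_fin.
    rewrite ifT; last lra.
    by rewrite -EFinB; congr EFin; lra.
have <- : (\int[lam]_x (\1_(box eta r) x)%:E = lam (box eta r))%E.
  by rewrite integral_indic ?setIT//; exact: measurable_box.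
by under eq_integral do rewrite indic_box; rewrite h ltry.
Qed.

End damped_kernel.

(** * Square norms of complex-valued functions *)

Section L2_norms.
Context {R : realType} {n : nat}.
Notation lam := (@lebesgue_cV R n).
Implicit Types f : 'cV[R]_n -> R[i].

Lemma normc_sqr (z : R[i]) : Normc.normc z ^+ 2 = complex.Re z ^+ 2 + complex.Im z ^+ 2.
Proof. by case: z => a b /=; rewrite sqr_sqrtr// addr_ge0 ?sqr_ge0. Qed.

Lemma normc_ge0 (z : R[i]) : 0 <= Normc.normc z.
Proof. by case: z => a b; exact: sqrtr_ge0. Qed.

Lemma LnormC2E f : (LnormC 2%:E f =
  (\int[lam]_x (complex.Re (f x) ^+ 2 + complex.Im (f x) ^+ 2)%:E) `^ 2^-1)%E.
Proof.
rewrite /LnormC unlock; congr (_ `^ _)%E; apply: eq_integral => x _.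
rewrite gee0_abs ?lee_fin ?normc_ge0// poweR_EFin -normc_sqr.
by rewrite powR_mulrn// normc_ge0.
Qed.

Lemma LnormC2_lty f :
  (\int[lam]_x (complex.Re (f x) ^+ 2 + complex.Im (f x) ^+ 2)%:E < +oo)%E ->
  (LnormC 2%:E f < +oo)%E.
Proof. by move=> h; rewrite LnormC2E poweR_lty. Qed.

Lemma LnormC2_cvg0 (f_ : nat -> 'cV[R]_n -> R[i]) :
  (\int[lam]_x (complex.Re (f_ k x) ^+ 2 + complex.Im (f_ k x) ^+ 2)%:E)%E
    @[k --> \oo] --> 0%E ->
  LnormC 2%:E (f_ k) @[k --> \oo] --> 0%E.
Proof.
set u := (fun k => _) => hu.
have u0 k : (0 <= u k)%E.
  by apply: integral_ge0 => x _; rewrite lee_fin addr_ge0 ?sqr_ge0.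
have [ufin uc] := (fine_cvgP u 0).1 hu.
have hs : (Num.sqrt (fine (u k)))%:E @[k --> \oo] --> 0%E.
  apply: cvg_EFin; first exact: nearW.
  rewrite -(@sqrtr0 R).
  exact: (cvg_comp _ _ uc (@sqrt_continuous R 0)).
apply: cvg_trans hs; apply: near_eq_cvg; near=> k.
have uk : u k \is a fin_num by near: k.
rewrite LnormC2E -/(u k) -{2}(fineK uk) poweR_EFin powR12_sqrt// fine_ge0//.
Unshelve. all: by end_near. Qed.

Lemma LnormC1_lty f (g : 'cV[R]_n -> R) :
  measurable_fun setT (fun x => complex.Re (f x)) ->
  measurable_fun setT (fun x => complex.Im (f x)) ->
  (forall x, `|complex.Re (f x)| <= g x) ->
  (forall x, `|complex.Im (f x)| <= g x) ->
  lam.-integrable setT (EFin \o g) -> (LnormC 1%:E f < +oo)%E.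
Proof.
move=> mr mi hr hi ig; rewrite /LnormC Lnorm1.
have mg : measurable_fun setT g by case/integrableP: ig => /measurable_EFinP.
have g0 x : 0 <= g x by exact: le_trans (hr x).
have mn : measurable_fun setT (fun x => Normc.normc (f x)).
  have -> : (fun x => Normc.normc (f x)) =
      (fun x => Num.sqrt (complex.Re (f x) ^+ 2 + complex.Im (f x) ^+ 2)).
    by apply/funext => x; case: (f x).
  apply: (@measurableT_comp _ _ _ _ _ _ (@Num.sqrt R)).
    by apply: continuous_measurable_fun; exact: sqrt_continuous.
  by apply: measurable_funD; exact: measurable_funX.
have ig2 : lam.-integrable setT (EFin \o (fun x => 2 * g x)).
  exact: integrable_scale.
apply: (@le_lt_trans _ _ (\int[lam]_x (2 * g x)%:E)%E); last first.
  by rewrite -EFin_Rintegral// ltry.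
apply: ge0_le_integral => //.
- by apply: measurableT_comp => //; exact/measurable_EFinP.
- by apply/measurable_EFinP; exact: measurable_funM.
move=> x _; rewrite gee0_abs ?lee_fin ?normc_ge0//.
rewrite -(@ler_sqr R) ?nnegrE ?normc_ge0 ?mulr_ge0// normc_sqr.
have := hr x; have := hi x; rewrite !ler_norml => /andP[h1 h2] /andP[h3 h4].
by have := g0 x; nra.
Qed.

End L2_norms.

(** * Indicator functions of open sets as Fourier transforms *)

Section inverse_fourier_indicator.
Context {R : realType} {n : nat}.
Notation lam := (@lebesgue_cV R n).
Variables (U : set 'cV[R]_n) (kap : R).
Hypothesis mU : measurable U.
Hypothesis Uoo : (lam U < +oo)%E.
Hypothesis kap0 : 0 <= kap.
Implicit Types (x xi eta w : 'cV[R]_n) (eps b : R).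

(** The function to be exhibited as a Fourier transform: [kap] times the indicator
    function of [U]. *)
Definition step xi : R := kap * \1_U xi.

Lemma step_ge0 xi : 0 <= step xi.
Proof. by rewrite mulr_ge0. Qed.

Lemma step_le xi : step xi <= kap.
Proof. by rewrite ler_piMr// indicE lern1 leq_b1. Qed.

Lemma step_sqr xi : step xi * step xi = kap * step xi.
Proof.
by rewrite /step indicE; case: (xi \in U); rewrite ?mulr1 ?mulr0 ?mul0r.
Qed.

Lemma measurable_step : measurable_fun setT step.
Proof. by apply: measurable_funM => //; exact: measurable_indic. Qed.

Lemma integrable_step : lam.-integrable setT (EFin \o step).
Proof.
apply: ge0_integrable; [exact: measurable_step|exact: step_ge0|].
under eq_integral do rewrite EFinM.
rewrite ge0_integralZl_EFin//; last by apply/measurable_EFinP; exact: measurable_indic.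
by rewrite integral_indic// setIT lte_mul_pinfty// lee_fin.
Qed.

(** The integral of [step]. *)
Definition mass : R := \int[lam]_xi step xi.

Lemma mass_ge0 : 0 <= mass.
Proof. by apply: Rintegral_ge0 => x _; exact: step_ge0. Qed.

(** The cosine of [2 pi <x, xi - eta> + b]; a quarter-turn of the phase [b] gives
    the sine. *)
Definition wave eta b x xi : R := cos (dotv x ((2 * pi) *: (xi - eta)) + b).

Lemma wave_norm eta b x xi : `|wave eta b x xi| <= 1.
Proof. by rewrite ler_norml cos_geN1 cos_le1. Qed.

Lemma measurable_coord_pair1 (i : 'I_n) :
  measurable_fun setT (fun p : 'cV[R]_n * 'cV[R]_n => p.1 i 0).
Proof. by apply: (measurableT_comp (measurable_coord_cV i)); exact: measurable_fst. Qed.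

Lemma measurable_coord_pair2 (i : 'I_n) :
  measurable_fun setT (fun p : 'cV[R]_n * 'cV[R]_n => p.2 i 0).
Proof. by apply: (measurableT_comp (measurable_coord_cV i)); exact: measurable_snd. Qed.

Lemma measurable_wave eta b : measurable_fun setT
  (fun p : 'cV[R]_n * 'cV[R]_n => wave eta b p.1 p.2).
Proof.
apply: (measurableT_comp measurable_cosT).
apply: measurable_funD => //; apply: measurable_sum => i.
apply: measurable_funM; first exact: measurable_coord_pair1.
under eq_fun do rewrite !mxE.
apply: measurable_funM => //; apply: measurable_funD => //.
exact: measurable_coord_pair2.
Qed.

Lemma measurable_step2 : measurable_fun setT
  (fun p : 'cV[R]_n * 'cV[R]_n => step p.2).
Proof. by apply: (measurableT_comp measurable_step); exact: measurable_snd. Qed.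

Lemma measurable_damp1 eps : measurable_fun setT
  (fun p : 'cV[R]_n * 'cV[R]_n => damp eps p.1).
Proof. by apply: (measurableT_comp (measurable_damp eps)); exact: measurable_fst. Qed.

Lemma measurable_wave2 eta b x : measurable_fun setT (wave eta b x).
Proof. exact: (measurableT_comp (measurable_wave eta b) (measurable_pair1 x)). Qed.

Lemma norm_step_wave eta b x xi : `|step xi * wave eta b x xi| <= step xi.
Proof.
by rewrite normrM ger0_norm ?step_ge0// ler_piMr ?step_ge0// wave_norm.
Qed.

Lemma integrable_step_wave eta b x :
  lam.-integrable setT (EFin \o (fun xi => step xi * wave eta b x xi)).
Proof.
apply: (integrable_dom (g := step)); last exact: integrable_step.
- by apply: measurable_funM; [exact: measurable_step|exact: measurable_wave2].
- by move=> xi; exact: norm_step_wave.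
Qed.

(** For [eta = 0], the real ([b = 0]) and imaginary ([b = - pi / 2]) parts of the
    inverse Fourier transform of [step]; in general, those of its modulation by
    the frequency [- eta]. *)
Definition synth eta b x : R := \int[lam]_xi (step xi * wave eta b x xi).

Lemma norm_synth eta b x : `|synth eta b x| <= mass.
Proof.
apply: Rintegral_norm_le; last exact: integrable_step.
- by apply: measurable_funM; [exact: measurable_step|exact: measurable_wave2].
- by move=> xi; exact: norm_step_wave.
Qed.

Lemma measurable_synth eta b : measurable_fun setT (synth eta b).
Proof.
have -> : synth eta b = (fun x =>
    fine (\int[lam]_xi (step xi * (1 + wave eta b x xi))%:E)%E - mass).
  apply/funext => x; rewrite -[fine _]/(\int[lam]_xi (step xi * (1 + wave eta b x xi))).
  under [in RHS]eq_Rintegral do rewrite mulrDr mulr1.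
  rewrite RintegralD//; last 2 first.
    exact: integrable_step.
    exact: integrable_step_wave.
  by rewrite addrC addKr.
apply: measurable_funB => //.
apply: (measurableT_comp (fine_measurable measurableT)) => //.
apply: (@measurable_fun_fubini_tonelli_F _ _ _ _ _ lam
  (fun p : 'cV[R]_n * 'cV[R]_n => (step p.2 * (1 + wave eta b p.1 p.2))%:E)) => //.
  apply/measurable_EFinP; apply: measurable_funM; first exact: measurable_step2.
  by apply: measurable_funD => //; exact: measurable_wave.
by move=> p; rewrite lee_fin mulr_ge0 ?step_ge0// -lerBlDl sub0r cos_geN1.
Qed.

(** The convolution of [step] with the Poisson kernel. *)
Definition smear eps eta : R := \int[lam]_xi (step xi * poisson_mx eps (xi - eta)).

Lemma integrable_step_poisson eps eta : 0 < eps ->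
  lam.-integrable setT (EFin \o (fun xi => step xi * poisson_mx eps (xi - eta))).
Proof.
move=> e0; apply: (integrable_dom (g := fun xi => kap * poisson_mx eps (xi - eta))).
- by apply: measurable_funM; [exact: measurable_step|exact: measurable_poisson_mxB].
- move=> xi; rewrite normrM !ger0_norm ?step_ge0 ?poisson_mx_ge0//.
  by rewrite ler_wpM2r ?step_le// poisson_mx_ge0.
- by apply: integrable_scale; exact: integrable_poisson_mx.
Qed.

Lemma smear_ge0 eps eta : 0 < eps -> 0 <= smear eps eta.
Proof.
by move=> e0; apply: Rintegral_ge0 => xi _; rewrite mulr_ge0 ?step_ge0 ?poisson_mx_ge0.
Qed.

Lemma smear_le eps eta : 0 < eps -> smear eps eta <= kap.
Proof.
move=> e0; have h1 : \int[lam]_xi poisson_mx eps (xi - eta) = 1.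
  by apply: Rintegral_EFin; rewrite integral_poisson_mx.
have ip : lam.-integrable setT (EFin \o (fun xi => poisson_mx eps (xi - eta))).
  exact: integrable_poisson_mx.
rewrite -[leRHS]mulr1 -h1 -RintegralZl//.
apply: le_Rintegral => //; first exact: integrable_step_poisson.
- by apply: integrable_scale; exact: integrable_poisson_mx.
- by move=> xi _; rewrite ler_wpM2r ?step_le// poisson_mx_ge0.
Qed.

Lemma integrable_damp_synth eps eta b : 0 < eps ->
  lam.-integrable setT (EFin \o (fun x => damp eps x * synth eta b x)).
Proof.
move=> e0; apply: (integrable_dom (g := fun x => mass * damp eps x)).
- by apply: measurable_funM; [exact: measurable_damp|exact: measurable_synth].
- move=> x; rewrite normrM ger0_norm ?(ltW (damp_gt0 _ _))// mulrC.
  by rewrite ler_wpM2r ?(ltW (damp_gt0 _ _))// norm_synth.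
- by apply: integrable_scale; exact: integrable_damp.
Qed.

Lemma Rintegral_damp_synth eps eta b : 0 < eps ->
  \int[lam]_x (damp eps x * synth eta b x) = cos b * smear eps eta.
Proof.
move=> e0.
pose h (p : 'cV[R]_n * 'cV[R]_n) := damp eps p.1 * (step p.2 * wave eta b p.1 p.2).
have mh : measurable_fun setT h.
  apply: measurable_funM; first exact: measurable_damp1.
  by apply: measurable_funM; [exact: measurable_step2|exact: measurable_wave].
have hh x xi : `|h (x, xi)| <= damp eps x * step xi.
  rewrite /h normrM ger0_norm ?(ltW (damp_gt0 _ _))//=.
  by rewrite ler_wpM2l ?(ltW (damp_gt0 _ _))// norm_step_wave.
have d0 x : 0 <= damp eps x by exact/ltW/damp_gt0.
have := Rfubini_dom mh hh d0 step_ge0 (integrable_damp e0) integrable_step.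
rewrite /h /=.
under eq_Rintegral => x _ do rewrite RintegralZl ?integrable_step_wave//.
move=> ->.
transitivity (\int[lam]_xi (cos b * (step xi * poisson_mx eps (xi - eta)))).
  apply: eq_Rintegral => xi _.
  under eq_Rintegral => x _ do rewrite mulrCA.
  rewrite RintegralZl; [|exact: measurableT|exact: integrable_damp_cos].
  rewrite Rintegral_damp_cos// mulrCA; congr (_ * (_ * _)).
  by apply: eq_bigr => i _; rewrite /poisson !mxE.
by apply: RintegralZl; [exact: measurableT|exact: integrable_step_poisson].
Qed.

(** The frequency [eta] at the point [x], as an angle. *)
Definition phase x eta : R := dotv x ((2 * pi) *: eta).

(** Addition formula for the cosine, applied under the integral. *)
Lemma synthE eta b x : synth eta b x =
  synth 0 0 x * cos (phase x eta - b) + synth 0 (- (pi / 2)) x * sin (phase x eta - b).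
Proof.
have iw r d : lam.-integrable setT
    (EFin \o (fun xi => step xi * wave 0 d x xi * r)).
  rewrite (_ : _ \o _ = (fun xi => r%:E * (step xi * wave 0 d x xi)%:E)%E).
    by apply: integrableZl => //; exact: integrable_step_wave.
  by apply/funext => xi /=; rewrite mulrC.
rewrite /synth -!RintegralZr//; [|exact: integrable_step_wave..].
rewrite -RintegralD//.
apply: eq_Rintegral => xi _; rewrite -!(mulrA (step xi)) -mulrDr; congr (_ * _).
rewrite /wave !subr0 addr0.
have -> : dotv x ((2 * pi) *: (xi - eta)) + b =
    dotv x ((2 * pi) *: xi) - (phase x eta - b).
  rewrite opprB addrA [RHS]addrAC; congr (_ + _).
  rewrite /phase /dotv -sumrB; apply: eq_bigr => i _.
  by rewrite !mxE; ring.
by rewrite cosB cosBpihalf.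
Qed.

Lemma synthE0 eta x : synth eta 0 x = synth 0 0 x * wave 0 0 x eta +
  synth 0 (- (pi / 2)) x * wave 0 (- (pi / 2)) x eta.
Proof.
by rewrite synthE /wave !subr0 addr0 cosBpihalf.
Qed.

(** The squared modulus of the inverse Fourier transform of [step]. *)
Definition power x : R := synth 0 0 x ^+ 2 + synth 0 (- (pi / 2)) x ^+ 2.

Lemma power_ge0 x : 0 <= power x.
Proof. by rewrite addr_ge0 ?sqr_ge0. Qed.

Lemma measurable_power : measurable_fun setT power.
Proof. by apply: measurable_funD; apply: measurable_funX; exact: measurable_synth. Qed.

Lemma power_le x : power x <= 2 * mass ^+ 2.
Proof.
rewrite /power mulr_natl mulr2n; apply: lerD.
  by rewrite -(real_normK (num_real (synth _ _ _))) lerXn2r ?nnegrE ?mass_ge0// norm_synth.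
by rewrite -(real_normK (num_real (synth _ _ _))) lerXn2r ?nnegrE ?mass_ge0// norm_synth.
Qed.

Lemma integrable_damp_power eps : 0 < eps ->
  lam.-integrable setT (EFin \o (fun x => damp eps x * power x)).
Proof.
move=> e0; apply: (integrable_dom (g := fun x => (2 * mass ^+ 2) * damp eps x)).
- by apply: measurable_funM; [exact: measurable_damp|exact: measurable_power].
- move=> x; rewrite ger0_norm ?mulr_ge0 ?power_ge0 ?(ltW (damp_gt0 _ _))// mulrC.
  by rewrite ler_wpM2r ?(ltW (damp_gt0 _ _))// power_le.
- by apply: integrable_scale; exact: integrable_damp.
Qed.

(** A damped form of the Plancherel identity. *)
Lemma Rintegral_damp_power eps : 0 < eps ->
  \int[lam]_x (damp eps x * power x) = \int[lam]_eta (step eta * smear eps eta).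
Proof.
move=> e0.
pose h (p : 'cV[R]_n * 'cV[R]_n) := damp eps p.1 * (step p.2 * synth p.2 0 p.1).
have ms b : measurable_fun setT (fun p : 'cV[R]_n * 'cV[R]_n => synth 0 b p.1).
  by apply: (measurableT_comp (measurable_synth 0 b)); exact: measurable_fst.
have mh : measurable_fun setT h.
  apply: measurable_funM; first exact: measurable_damp1.
  apply: measurable_funM; first exact: measurable_step2.
  under eq_fun do rewrite synthE0.
  by apply: measurable_funD; apply: measurable_funM => //; exact: measurable_wave.
have hh x eta : `|h (x, eta)| <= (mass * damp eps x) * step eta.
  rewrite /h /= normrM (ger0_norm (ltW (damp_gt0 _ _))) normrM (ger0_norm (step_ge0 _)).
  rewrite [leRHS](_ : _ = damp eps x * (step eta * mass)); last by ring.
  by rewrite !ler_wpM2l ?step_ge0 ?(ltW (damp_gt0 _ _))// norm_synth.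
have d0 x : 0 <= mass * damp eps x.
  by rewrite mulr_ge0 ?mass_ge0// (ltW (damp_gt0 _ _)).
have id : lam.-integrable setT (EFin \o (fun x => mass * damp eps x)).
  by apply: integrable_scale; exact: integrable_damp.
have := Rfubini_dom mh hh d0 step_ge0 id integrable_step.
rewrite /h /= => hF.
transitivity (\int[lam]_x \int[lam]_eta (damp eps x * (step eta * synth eta 0 x))).
  apply: eq_Rintegral => x _.
  have -> : (fun eta => damp eps x * (step eta * synth eta 0 x)) =
     (fun eta => damp eps x * synth 0 0 x * (step eta * wave 0 0 x eta) +
        damp eps x * synth 0 (- (pi / 2)) x * (step eta * wave 0 (- (pi / 2)) x eta)).
    by apply/funext => eta; rewrite synthE0; ring.
  have iw r d : lam.-integrable setT
      (EFin \o (fun eta => r * (step eta * wave 0 d x eta))).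
    by apply: integrable_scale; exact: integrable_step_wave.
  have Z r d : \int[lam]_eta (r * (step eta * wave 0 d x eta)) = r * synth 0 d x.
    by apply: RintegralZl; [exact: measurableT|exact: integrable_step_wave].
  rewrite RintegralD; [|exact: measurableT|exact: iw|exact: iw].
  by rewrite !Z /power !expr2 mulrDr !mulrA.
rewrite hF; apply: eq_Rintegral => eta _.
under eq_Rintegral => x _ do rewrite mulrCA.
rewrite RintegralZl; [|exact: measurableT|exact: integrable_damp_synth].
by rewrite (Rintegral_damp_synth eta 0 e0) cos0 mul1r.
Qed.

Lemma measurable_poisson_mx2 eps : 0 < eps -> measurable_fun setT
  (fun p : 'cV[R]_n * 'cV[R]_n => poisson_mx eps (p.2 - p.1)).
Proof.
move=> e0; apply: measurable_prod => i _.
apply: (measurableT_comp (measurable_poisson e0)).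
under eq_fun do rewrite !mxE.
by apply: measurable_funB; [exact: measurable_coord_pair2|exact: measurable_coord_pair1].
Qed.

Lemma measurable_step_poisson2 eps : 0 < eps -> measurable_fun setT
  (fun p : 'cV[R]_n * 'cV[R]_n => (step p.2 * poisson_mx eps (p.2 - p.1))%:E).
Proof.
move=> e0; apply/measurable_EFinP; apply: measurable_funM.
  exact: measurable_step2.
exact: measurable_poisson_mx2.
Qed.

Lemma step_poisson_ge0 eps (p : 'cV[R]_n * 'cV[R]_n) : 0 < eps ->
  (0 <= (step p.2 * poisson_mx eps (p.2 - p.1))%:E)%E.
Proof. by move=> e0; rewrite lee_fin mulr_ge0 ?step_ge0 ?poisson_mx_ge0. Qed.

Lemma measurable_smear eps : 0 < eps -> measurable_fun setT (smear eps).
Proof.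
move=> e0.
have -> : smear eps = fine \o (fun eta =>
  \int[lam]_xi (step xi * poisson_mx eps (xi - eta))%:E)%E by [].
apply: (measurableT_comp (fine_measurable measurableT)).
apply: (@measurable_fun_fubini_tonelli_F _ _ _ _ _ lam
  (fun p : 'cV[R]_n * 'cV[R]_n => (step p.2 * poisson_mx eps (p.2 - p.1))%:E)).
  exact: measurable_step_poisson2.
by move=> p; exact: step_poisson_ge0.
Qed.

Lemma integral_smear eps : 0 < eps -> (\int[lam]_eta (smear eps eta)%:E = mass%:E)%E.
Proof.
move=> e0.
under eq_integral do rewrite /smear EFin_Rintegral ?integrable_step_poisson//.
rewrite (@fubini_tonelli _ _ _ _ _ lam lam
  (fun p : 'cV[R]_n * 'cV[R]_n => (step p.2 * poisson_mx eps (p.2 - p.1))%:E)) /=; last 2 first.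
- exact: measurable_step_poisson2.
- by move=> p; exact: step_poisson_ge0.
rewrite EFin_Rintegral; last exact: integrable_step.
apply: eq_integral => xi _.
under eq_integral do rewrite EFinM poisson_mxB.
rewrite ge0_integralZl_EFin ?step_ge0//.
- by rewrite integral_poisson_mx// mule1.
- by move=> x _; rewrite lee_fin poisson_mx_ge0.
- by apply/measurable_EFinP; exact: measurable_poisson_mxB.
Qed.

Lemma integrable_smear eps : 0 < eps -> lam.-integrable setT (EFin \o smear eps).
Proof.
move=> e0; apply: ge0_integrable; first exact: measurable_smear.
  by move=> eta; exact: smear_ge0.
by rewrite integral_smear// ltry.
Qed.

Lemma step_smear_le eps eta : 0 < eps -> step eta * smear eps eta <= kap * step eta.
Proof. by move=> e0; rewrite mulrC ler_wpM2r ?step_ge0 ?smear_le. Qed.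

Lemma integrable_kap_step : lam.-integrable setT (EFin \o (fun x => kap * step x)).
Proof.
by apply: integrable_scale; exact: integrable_step.
Qed.

Lemma integrable_step_smear eps : 0 < eps ->
  lam.-integrable setT (EFin \o (fun x => step x * smear eps x)).
Proof.
move=> e0; apply: integrable_dom integrable_kap_step.
  by apply: measurable_funM; [exact: measurable_step|exact: measurable_smear].
by move=> x; rewrite ger0_norm ?mulr_ge0 ?step_ge0 ?smear_ge0// step_smear_le.
Qed.

Lemma Rintegral_step_smear_le eps : 0 < eps ->
  \int[lam]_eta (step eta * smear eps eta) <= kap * mass.
Proof.
move=> e0; rewrite /mass -RintegralZl; [|exact: measurableT|exact: integrable_step].
apply: le_Rintegral => //.
- exact: integrable_step_smear.
- exact: integrable_kap_step.
- by move=> x _; exact: step_smear_le.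
Qed.

(** The damping parameters. *)
Definition eps_ (k : nat) : R := k.+1%:R^-1.

Lemma eps_gt0 k : 0 < eps_ k.
Proof. by rewrite invr_gt0. Qed.

Lemma dampE eps x : damp eps x = expR (- (eps * \sum_i `|x i 0|)).
Proof. by rewrite mulr_sumr -sumrN expR_sum. Qed.

Lemma cvg_damp x : damp (eps_ k) x @[k --> \oo] --> (1 : R).
Proof.
set s := \sum_i `|x i 0|.
have h : - (eps_ k * s) @[k --> \oo] --> - (0 * s).
  by apply: cvgN; apply: cvgMr_tmp; exact: cvg_harmonic.
rewrite mul0r oppr0 in h.
under eq_fun do rewrite dampE; rewrite -expR0.
exact: (cvg_comp _ _ h (@continuous_expR R 0)).
Qed.

Lemma damp_le1 k x : damp (eps_ k) x <= 1.
Proof.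
by rewrite dampE -expR0 ler_expR oppr_le0 mulr_ge0 ?(ltW (eps_gt0 _))// sumr_ge0.
Qed.

Lemma cvg_EFin_seq (u : R^nat) (l : R) : u @ \oo --> l -> (u k)%:E @[k --> \oo] --> l%:E.
Proof. by move=> h; apply: cvg_EFin => //; exact: nearW. Qed.

Lemma integral_power_le : (\int[lam]_x (power x)%:E <= (kap * mass)%:E)%E.
Proof.
have -> : (\int[lam]_x (power x)%:E =
    \int[lam]_x (limn_einf (fun k => (damp (eps_ k) x * power x)%:E)))%E.
  apply: eq_integral => x _; apply/esym.
  have h : (damp (eps_ k) x * power x)%:E @[k --> \oo] --> (power x)%:E.
    by apply: cvg_EFin_seq; rewrite -[X in _ --> X]mul1r; apply: cvgMr_tmp; exact: cvg_damp.
  by have [-> _] := cvg_limn_einf_sup h.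
apply: le_trans (fatou _ _ _ _) _ => //.
- move=> k; apply/measurable_EFinP; apply: measurable_funM; first exact: measurable_damp.
  exact: measurable_power.
- by move=> k x _; rewrite lee_fin mulr_ge0 ?power_ge0// ltW// damp_gt0.
rewrite limn_einf_lim; apply: lime_le; first exact: is_cvg_einfs.
apply: nearW => k.
apply: (@le_trans _ _ (\int[lam]_x (damp (eps_ k) x * power x)%:E)%E).
  by apply: ereal_inf_lbound; exists k => /=.
rewrite -EFin_Rintegral; last by apply: integrable_damp_power; exact: eps_gt0.
rewrite lee_fin Rintegral_damp_power ?eps_gt0//.
exact/Rintegral_step_smear_le/eps_gt0.
Qed.

Lemma cvg_atan_eps r : 0 < r ->
  2 / pi * atan (2 * pi / eps_ k * r) @[k --> \oo] --> (1 : R).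
Proof.
move=> r0; have p0 : 0 < pi :> R by exact: pi_gt0.
have E : 2 / pi * (pi / 2) = 1 :> R.
  by move: (@pi R) p0 => p p0; field; rewrite gt_eqF.
rewrite -[X in _ --> X]E.
apply: cvgMl_tmp.
apply: (@cvg_comp _ _ _ (fun k => 2 * pi / eps_ k * r) (@atan R) _ (+oo));
  last exact: cvgy_atan.
under eq_fun do rewrite /eps_ invrK mulrAC.
have h : (k.+1%:R : R) @[k --> \oo] --> +oo.
  by have := @cvgr_idn R; rewrite -cvg_shiftS.
apply: (@cvg_comp _ _ _ (fun k => k.+1%:R : R) (fun y => 2 * pi * r * y) _ (+oo)) => //.
by apply: gt0_cvgMry; [rewrite !mulr_gt0|exact: cvg_id].
Qed.

Lemma cvg_smear eta : open U -> U eta -> smear (eps_ k) eta @[k --> \oo] --> kap.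
Proof.
move=> oU Ueta.
have /nbhs_ballP[r /= r0 rU] : nbhs eta U by exact: open_nbhs_nbhs.
have boxU : box eta r `<=` U.
  move=> x hx; apply: rU; split => // i j; rewrite (ord1 j) /ball /= distrC.
  exact: hx.
(* the contribution of a cube contained in [U] to the convolution at its center *)
pose low k := kap * (2 / pi * atan (2 * pi / eps_ k * r)) ^+ n.
apply: (@squeeze_cvgr _ _ _ _ low (fun=> kap)); last 2 first.
- have h : low k @[k --> \oo] --> kap * 1 ^+ n.
    apply: cvgMl_tmp.
    exact: (cvg_comp _ _ (cvg_atan_eps r0) (@exprn_continuous R n 1)).
  by rewrite expr1n mulr1 in h.
- exact: cvg_cst.
apply: nearW => k; have e0 := eps_gt0 k; rewrite smear_le// andbT.
have ib : lam.-integrable setT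
    (EFin \o (fun x => poisson_mx (eps_ k) (x - eta) * \1_(box eta r) x)).
  apply: integrable_dom (integrable_poisson_mx eta e0).
    apply: measurable_funM; first exact: measurable_poisson_mxB.
    by apply: measurable_indic; exact: measurable_box.
  move=> x; rewrite normrM !ger0_norm ?poisson_mx_ge0//.
  by rewrite ler_piMr ?poisson_mx_ge0// indicE lern1 leq_b1.
rewrite /low -(Rintegral_EFin (integral_poisson_box eta e0 r0)).
rewrite -RintegralZl; [|exact: measurableT|exact: ib].
apply: le_Rintegral => //.
- exact: integrable_scale.
- exact: integrable_step_poisson.
move=> x _; rewrite mulrCA mulrC ler_wpM2r ?poisson_mx_ge0// /step ler_wpM2l//.
rewrite !indicE ler_nat.
have [h|h] := pselect (box eta r x); last by rewrite memNset.
by rewrite !mem_set//; exact: boxU.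
Qed.

Lemma integral_dominated_cvg (u : nat -> 'cV[R]_n -> R) (v g : 'cV[R]_n -> R) :
  (forall k, measurable_fun setT (u k)) -> (forall k x, `|u k x| <= g x) ->
  (forall x, u k x @[k --> \oo] --> v x) -> lam.-integrable setT (EFin \o g) ->
  (\int[lam]_x (u k x)%:E)%E @[k --> \oo] --> (\int[lam]_x (v x)%:E)%E.
Proof.
move=> mu_ hu uv ig.
apply: (@dominated_cvg _ _ _ lam setT measurableT (fun k x => (u k x)%:E)
  (fun x => (v x)%:E) (EFin \o g)) => //.
- by move=> k; exact/measurable_EFinP.
- by move=> x _; exact: cvg_EFin_seq.
- by move=> k x _; rewrite /= lee_fin.
Qed.

Lemma cvg_step_smear : open U ->
  (\int[lam]_x (step x * smear (eps_ k) x)%:E)%E @[k --> \oo] --> (kap * mass)%:E.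
Proof.
move=> oU.
have -> : (kap * mass)%:E = (\int[lam]_x (kap * step x)%:E)%E.
  rewrite -EFin_Rintegral; last exact: integrable_kap_step.
  by rewrite RintegralZl; [|exact: measurableT|exact: integrable_step].
apply: (integral_dominated_cvg _ _ _ integrable_kap_step).
- move=> k; apply: measurable_funM; first exact: measurable_step.
  by apply: measurable_smear; exact: eps_gt0.
- move=> k x; rewrite ger0_norm ?mulr_ge0 ?step_ge0 ?smear_ge0 ?eps_gt0//.
  by apply: step_smear_le; exact: eps_gt0.
move=> x; rewrite (mulrC kap).
have [h|h] := pselect (U x); first by apply: cvgMl_tmp; exact: cvg_smear.
rewrite /step indicE memNset// mulr0 mul0r.
by under eq_fun do rewrite mul0r; exact: cvg_cst.
Qed.

(** The square of [smear - step] is at most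
    [kap * smear + kap * step - 2 * step * smear], because [0 <= smear <= kap]
    and [step] only takes the values [0] and [kap]. *)
Lemma cvg_smear_L2 : open U ->
  (\int[lam]_x ((smear (eps_ k) x - step x) ^+ 2)%:E)%E @[k --> \oo] --> 0%E.
Proof.
move=> oU.
(* the integral of the dominating function [D] below *)
pose bound k := ((2 * (kap * mass))%:E
   - 2%:E * \int[lam]_x (step x * smear (eps_ k) x)%:E)%E.
have hb : bound k @[k --> \oo] --> 0%E.
  rewrite (_ : 0%E = (2 * (kap * mass))%:E - 2%:E * (kap * mass)%:E)%E; last first.
    by rewrite -EFinM -EFinB subrr.
  by apply: cvgeB => //; [exact: cvg_cst|apply: cvgeZl => //; exact: cvg_step_smear].
apply: (@squeeze_cvge _ _ _ _ (fun=> 0%E) _ bound); last 2 first.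
- exact: cvg_cst.
- exact: hb.
apply: nearW => k; have e0 := eps_gt0 k; apply/andP; split.
  by apply: integral_ge0 => x _; rewrite lee_fin sqr_ge0.
have is1 := integrable_step_smear e0.
have is2 : lam.-integrable setT (EFin \o (fun x => kap * smear (eps_ k) x)).
  by apply: integrable_scale; exact: integrable_smear.
have is3 : lam.-integrable setT (EFin \o (fun x => 2 * (step x * smear (eps_ k) x))).
  exact: integrable_scale.
have is4 : lam.-integrable setT
    (EFin \o (fun x => kap * smear (eps_ k) x + kap * step x)).
  exact: (integrableD measurableT is2 integrable_kap_step).
pose D x := kap * smear (eps_ k) x + kap * step x - 2 * (step x * smear (eps_ k) x).
have mD : measurable_fun setT D.
  apply: measurable_funB.
    by case/integrableP: is4 => /measurable_EFinP.
  by case/integrableP: is3 => /measurable_EFinP.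
have hD x : (smear (eps_ k) x - step x) ^+ 2 <= D x.
  have := step_sqr x; have := smear_le x e0; have := smear_ge0 x e0.
  rewrite /D; move: (smear _ _) (step x) => a b a0 ak bE.
  have -> : (a - b) ^+ 2 = a * a + b * b - 2 * (b * a) by ring.
  by rewrite bE lerD2r lerD2r ler_wpM2r.
have -> : bound k = (\int[lam]_x (D x)%:E)%E.
  rewrite -EFin_Rintegral; last exact: (integrableB measurableT is4 is3).
  rewrite /bound -EFin_Rintegral; last exact: is1.
  rewrite -EFinM -EFinB; congr EFin.
  rewrite /D RintegralB; [|exact: measurableT|exact: is4|exact: is3].
  rewrite RintegralD; [|exact: measurableT|exact: is2|exact: integrable_kap_step].
  rewrite RintegralZl; [|exact: measurableT|exact: integrable_smear].
  rewrite RintegralZl; [|exact: measurableT|exact: integrable_step].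
  rewrite RintegralZl; [|exact: measurableT|exact: is1].
  rewrite (Rintegral_EFin (integral_smear e0)) -/mass mulr_natl mulr2n.
  by [].
apply: ge0_le_integral => //.
- by move=> x _; rewrite lee_fin sqr_ge0.
- apply/measurable_EFinP; apply: measurable_funX; apply: measurable_funB.
    exact: measurable_smear.
  exact: measurable_step.
- exact/measurable_EFinP.
- by move=> x _; rewrite lee_fin.
Qed.

(** The inverse Fourier transform of [step] and its damped approximations. *)
Definition psi x : R[i] := Complex (synth 0 0 x) (synth 0 (- (pi / 2)) x).

Definition psi_ k x : R[i] := Complex (damp (eps_ k) x * synth 0 0 x)
  (damp (eps_ k) x * synth 0 (- (pi / 2)) x).

Lemma Re_mul_Complex (a b c d : R) :
  complex.Re (Complex a b * Complex c d) = a * c - b * d.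
Proof. by []. Qed.

Lemma Im_mul_Complex (a b c d : R) :
  complex.Im (Complex a b * Complex c d) = a * d + b * c.
Proof. by []. Qed.

Lemma fourier_psi_ k eta : fourier (psi_ k) eta = Complex (smear (eps_ k) eta) 0.
Proof.
have e0 := eps_gt0 k.
have phE x : 2 * pi * dotv x eta = phase x eta.
  by rewrite /phase /dotv mulr_sumr; apply: eq_bigr => i _; rewrite mxE; ring.
rewrite /fourier /integralC; congr Complex.
- transitivity (\int[lam]_x (damp (eps_ k) x * synth eta 0 x)); last first.
    by rewrite (Rintegral_damp_synth eta 0 e0) cos0 mul1r.
  apply: eq_Rintegral => x _.
  transitivity (complex.Re (psi_ k x * expi (- phase x eta))).
    by rewrite -phE.
  rewrite (synthE eta 0) subr0 /psi_ /expi cosN sinN Re_mul_Complex.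
  by rewrite mulrN opprK mulrDr !mulrA.
- transitivity (\int[lam]_x (damp (eps_ k) x * synth eta (- (pi / 2)) x)); last first.
    by rewrite (Rintegral_damp_synth eta _ e0) cosN cos_pihalf mul0r.
  apply: eq_Rintegral => x _.
  transitivity (complex.Im (psi_ k x * expi (- phase x eta))).
    by rewrite -phE.
  rewrite (synthE eta) opprK cosDpihalf sinDpihalf /psi_ /expi cosN sinN Im_mul_Complex.
  by rewrite mulrDr !mulrA.
Qed.

Lemma LpC_psi : LpC 2%:E psi.
Proof.
split; [exact: measurable_synth|exact: measurable_synth|].
apply: LnormC2_lty; apply: (le_lt_trans integral_power_le).
by rewrite ltry.
Qed.

Lemma integrable_power : lam.-integrable setT (EFin \o power).
Proof.
apply: ge0_integrable; [exact: measurable_power|exact: power_ge0|].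
by apply: (le_lt_trans integral_power_le); rewrite ltry.
Qed.

Lemma measurable_psi_re k : measurable_fun setT (fun x => complex.Re (psi_ k x)).
Proof. by apply: measurable_funM; [exact: measurable_damp|exact: measurable_synth]. Qed.

Lemma measurable_psi_im k : measurable_fun setT (fun x => complex.Im (psi_ k x)).
Proof. by apply: measurable_funM; [exact: measurable_damp|exact: measurable_synth]. Qed.

Lemma psi_power k x : complex.Re (psi_ k x) ^+ 2 + complex.Im (psi_ k x) ^+ 2 =
  damp (eps_ k) x ^+ 2 * power x.
Proof. by rewrite /= /power; ring. Qed.

Lemma LpC1_psi_ k : LpC 1%:E (psi_ k).
Proof.
split; [exact: measurable_psi_re|exact: measurable_psi_im|].
apply: (@LnormC1_lty _ _ _ (fun x => mass * damp (eps_ k) x)).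
- exact: measurable_psi_re.
- exact: measurable_psi_im.
- move=> x /=; rewrite normrM ger0_norm ?(ltW (damp_gt0 _ _))// mulrC.
  by rewrite ler_wpM2r ?(ltW (damp_gt0 _ _))// norm_synth.
- move=> x /=; rewrite normrM ger0_norm ?(ltW (damp_gt0 _ _))// mulrC.
  by rewrite ler_wpM2r ?(ltW (damp_gt0 _ _))// norm_synth.
- by apply: integrable_scale; apply: integrable_damp; exact: eps_gt0.
Qed.

Lemma LpC2_psi_ k : LpC 2%:E (psi_ k).
Proof.
split; [exact: measurable_psi_re|exact: measurable_psi_im|].
apply: LnormC2_lty.
apply: (@le_lt_trans _ _ (\int[lam]_x (power x)%:E)%E); last first.
  by apply: (le_lt_trans integral_power_le); rewrite ltry.
apply: ge0_le_integral => //.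
- by move=> x _; rewrite lee_fin addr_ge0 ?sqr_ge0.
- apply/measurable_EFinP; apply: measurable_funD; apply: measurable_funX.
    exact: measurable_psi_re.
  exact: measurable_psi_im.
- apply/measurable_EFinP; exact: measurable_power.
move=> x _; rewrite psi_power lee_fin ler_piMl ?power_ge0//.
by rewrite exprn_ile1 ?damp_le1// ltW// damp_gt0.
Qed.

Lemma cvg_psi_ : LnormC 2%:E (fun x => psi_ k x - psi x) @[k --> \oo] --> 0%E.
Proof.
apply: LnormC2_cvg0.
have E k x : complex.Re (psi_ k x - psi x) ^+ 2 + complex.Im (psi_ k x - psi x) ^+ 2 =
    (damp (eps_ k) x - 1) ^+ 2 * power x.
  by rewrite /= /power; ring.
under eq_fun do under eq_integral do rewrite E.
have -> : 0%E = (\int[lam]_x (0 : R)%:E)%E by rewrite integral0.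
apply: (integral_dominated_cvg _ _ _ integrable_power).
- move=> k; apply: measurable_funM; last exact: measurable_power.
  by apply: measurable_funX; apply: measurable_funB => //; exact: measurable_damp.
- move=> k x; rewrite normrM !ger0_norm ?sqr_ge0 ?power_ge0//.
  apply: ler_piMl; first exact: power_ge0.
  rewrite -sqrrN opprB; apply: exprn_ile1.
    by rewrite subr_ge0 damp_le1.
  by rewrite gerBl ltW// damp_gt0.
- move=> x; rewrite -(mul0r (power x)); apply: cvgMr_tmp.
  have h : damp (eps_ k) x - 1 @[k --> \oo] --> (1 - 1 : R).
    by apply: cvgB; [exact: cvg_damp|exact: cvg_cst].
  have := cvg_comp _ _ h (@exprn_continuous R 2 (1 - 1)).
  by rewrite subrr expr0n.
Qed.

Lemma is_fourier_L2_step : open U ->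
  is_fourier_L2 psi (fun xi => Complex (step xi) 0).
Proof.
move=> oU; split; first exact: LpC_psi.
- split => /=; [exact: measurable_step|exact: measurable_cst|].
  apply: LnormC2_lty => /=.
  under eq_integral do rewrite expr0n /= addr0 expr2 step_sqr.
  by rewrite -EFin_Rintegral ?ltry//; exact: integrable_kap_step.
exists psi_; split.
- by move=> k; split; [exact: LpC1_psi_|exact: LpC2_psi_].
- exact: cvg_psi_.
- apply: LnormC2_cvg0.
  under eq_fun do under eq_integral do rewrite fourier_psi_ /= subr0 expr0n /= addr0.
  exact: cvg_smear_L2.
Qed.

End inverse_fourier_indicator.

(** * Admissibility *)

Lemma shell_lty {R : realType} {n : nat} (B : 'M[R]_n) :
  (lebesgue_cV n (shell B) < +oo)%E.
Proof.
have [r hr] := bounded_shell B.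
have r0 : 0 < `|r| + 1 by rewrite ltr_wpDl.
apply: le_lt_trans (box_lty (0 : 'cV[R]_n) r0).
apply: le_measure; rewrite ?inE; [|exact: measurable_box|].
  by apply: sub_sigma_algebra; exact: open_shell.
move=> v hv i; rewrite mxE subr0 (le_lt_trans (hr v hv i))//.
by rewrite ltr_pwDr// ler_norm.
Qed.

Lemma admissible_expanding {R : realType} {n : nat} (B : 'M[R]_n) :
  expanding B -> admissible (one_param_group B).
Proof.
move=> hB; split; first exact: closed_subgroup_one_param.
move=> mu hmu.
pose c := fine (mu (expmx_arc B 0 1)).
have c0 : 0 <= (Num.sqrt c)^-1 by rewrite invr_ge0 sqrtr_ge0.
have oS := @open_shell R n B.
have mS : measurable (shell B) by exact: sub_sigma_algebra.
have hF := is_fourier_L2_step mS (shell_lty B) c0 oS.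
eexists; eexists; split; [|exact: hF|].
  by case: hF.
by apply: aeW => xi xi0; exact: (Delta_shell hmu hB xi0).
Qed.

Theorem theorem2p1 (R : realType) (n : nat) (M A : 'M[R]_n)
  (hM : orthogonally_diagonalizable M)
  (heig : (forall l : R, eigenvalue M l -> 0 < l) \/
          (forall l : R, eigenvalue M l -> l < 0))
  (hA : A^T = - A) :
  admissible (one_param_group (M + A)).
Proof.
have [hB|hB] := expanding_or hM heig hA; first exact: admissible_expanding.
by rewrite -one_param_groupN; exact: admissible_expanding.
Qed.
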